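(* For $i=1,2$ let $G_i$ be an étale groupoid whose unit space is compact and totally disconnected. If $G_1$ and $G_2$ are Kakutani equivalent, then $G_1$ is homologically similar to $G_2$. In particular $H_n(G_1,A)\cong H_n(G_2,A)$ for every $n$ and every topological abelian group $A$, and there is an isomorphism $\pi:H_0(G_1)\to H_0(G_2)$ with $\pi(H_0(G_1)^+)=H_0(G_2)^+$.
   Context: An étale groupoid is a locally compact Hausdorff groupoid whose range map $r$ is a local homeomorphism; $s$ is the source map. $Y\subset G^{(0)}$ is $G$-full if for every $x\in G^{(0)}$ there is $g$ with $r(g)=x$, $s(g)\in Y$; $G|Y=r^{-1}(Y)\cap s^{-1}(Y)$. $G_1,G_2$ are Kakutani equivalent if there are $G_i$-full clopen $Y_i\subset G_i^{(0)}$ with $G_1|Y_1\cong G_2|Y_2$ as topological groupoids. A homomorphism is a continuous map preserving composable pairs and products; it is étale if it is a local homeomorphism. Homomorphisms $\rho,\sigma:G\to H$ are similar if there is a continuous $\theta:G^{(0)}\to H$ with $\theta(r(g))\rho(g)=\sigma(g)\theta(s(g))$ for all $g$. $G,H$ are homologically similar if there are étale homomorphisms $\rho:G\to H$, $\sigma:H\to G$ with $\sigma\circ\rho$ similar to $\mathrm{id}_G$ and $\rho\circ\sigma$ similar to $\mathrm{id}_H$. Homology with coefficients $A$: $G^{(n)}$ composable $n$-strings, $d_0,\dots,d_n$ the face maps (delete first entry, multiply adjacent entries, delete last entry), $\pi_*(f)(y)=\sum_{\pi(x)=y}f(x)$ on $C_c(\cdot,A)$, $\delta_1=s_*-r_*$,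 $\delta_n=\sum_{i=0}^n(-1)^id_{i*}$, $H_n(G,A)=\ker\delta_n/\operatorname{Im}\delta_{n+1}$; $H_0(G)=H_0(G,\mathbb{Z})$ and $H_0(G)^+=\{[f]: f\ge0\}$. *)

(* Defs.v *)
From HB Require Import structures.
From mathcomp Require Import all_boot all_order all_algebra.
From mathcomp Require Import all_classical all_reals all_analysis.

Set Implicit Arguments.
Unset Strict Implicit.
Unset Printing Implicit Defensive.
Import Order.TTheory GRing.Theory Num.Theory.
Local Open Scope classical_set_scope.
Local Open Scope ring_scope.

(* f is a local homeomorphism: continuous, and every point has an open
   neighbourhood U on which f is injective and open (hence f restricted to U
   is a homeomorphism onto the open set f(U)). *)
Definition local_homeo (T U : topologicalType) (f : T -> U) : Prop :=
  continuous f /\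
  forall x : T, exists O : set T,
    [/\ open O, O x, {in O &, injective f} &
        forall V : set T, open V -> V `<=` O -> open (f @` V)].

(* The unit space G^(0) is carried by its own topological space [gunit];
   [gid] is the embedding of units into arrows (it is a topological embedding
   since [grange \o gid = id] with [grange] continuous).  Multiplication is a
   total function, meaningful only on composable pairs (s g = r h). *)
Record etale_groupoid := EtaleGroupoid {
  gcar : topologicalType;
  gunit : topologicalType;
  grange : gcar -> gunit;
  gsource : gcar -> gunit;
  gid : gunit -> gcar;
  gmul : gcar -> gcar -> gcar;
  ginv : gcar -> gcar;
  grange_id : forall x, grange (gid x) = x;
  gsource_id : forall x, gsource (gid x) = x;
  grange_mul : forall g h, gsource g = grange h -> grange (gmul g h) = grange g;
  gsource_mul : forall g h, gsource g = grange h -> gsource (gmul g h) = gsource h;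
  gmulA : forall g h k, gsource g = grange h -> gsource h = grange k ->
    gmul (gmul g h) k = gmul g (gmul h k);
  gid_mul : forall g, gmul (gid (grange g)) g = g;
  gmul_id : forall g, gmul g (gid (gsource g)) = g;
  grange_inv : forall g, grange (ginv g) = gsource g;
  gsource_inv : forall g, gsource (ginv g) = grange g;
  gmulV : forall g, gmul g (ginv g) = gid (grange g);
  gmulVl : forall g, gmul (ginv g) g = gid (gsource g);
  gcar_hausdorff : hausdorff_space gcar;
  gcar_locally_compact : locally_compact [set: gcar];
  gunit_hausdorff : hausdorff_space gunit;
  gsource_cont : continuous gsource;
  gid_cont : continuous gid;
  ginv_cont : continuous ginv;
  gmul_cont : {within [set p : gcar * gcar | gsource p.1 = grange p.2],
                continuous (fun p : gcar * gcar => gmul p.1 p.2)};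
  grange_etale : local_homeo grange
}.

Arguments grange {e}.
Arguments gsource {e}.
Arguments gid {e}.
Arguments gmul {e}.
Arguments ginv {e}.

Definition gfull (G : etale_groupoid) (Y : set (gunit G)) : Prop :=
  forall x : gunit G, exists g : gcar G, grange g = x /\ Y (gsource g).

Definition reduction (G : etale_groupoid) (Y : set (gunit G)) : set (gcar G) :=
  [set g | Y (grange g) /\ Y (gsource g)].

(* f : G -> H is a groupoid homomorphism on the subset D of arrows
   (D is closed under composable products in our uses): it maps composable
   pairs of D to composable pairs and preserves products. *)
Definition hom_on (G H : etale_groupoid) (D : set (gcar G))
    (f : gcar G -> gcar H) : Prop :=
  forall g h, D g -> D h -> gsource g = grange h ->
    gsource (f g) = grange (f h) /\ f (gmul g h) = gmul (f g) (f h).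

Definition reductions_iso (G1 G2 : etale_groupoid)
    (Y1 : set (gunit G1)) (Y2 : set (gunit G2)) : Prop :=
  exists (phi : gcar G1 -> gcar G2) (psi : gcar G2 -> gcar G1),
    [/\ (forall g, reduction Y1 g -> reduction Y2 (phi g)),
        (forall h, reduction Y2 h -> reduction Y1 (psi h)),
        (forall g, reduction Y1 g -> psi (phi g) = g) &
        (forall h, reduction Y2 h -> phi (psi h) = h)] /\
    [/\ {within reduction Y1, continuous phi},
        {within reduction Y2, continuous psi},
        hom_on (reduction Y1) phi &
        hom_on (reduction Y2) psi].

Definition kakutani_equivalent (G1 G2 : etale_groupoid) : Prop :=
  exists (Y1 : set (gunit G1)) (Y2 : set (gunit G2)),
    [/\ clopen Y1, gfull Y1, clopen Y2, gfull Y2 & reductions_iso Y1 Y2].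

Definition homomorphism (G H : etale_groupoid) (f : gcar G -> gcar H) : Prop :=
  continuous f /\ hom_on [set: gcar G] f.

Definition etale_homomorphism (G H : etale_groupoid)
    (f : gcar G -> gcar H) : Prop :=
  homomorphism f /\ local_homeo f.

Definition similar (G H : etale_groupoid) (rho sigma : gcar G -> gcar H) : Prop :=
  exists theta : gunit G -> gcar H,
    continuous theta /\
    forall g : gcar G,
      [/\ gsource (theta (grange g)) = grange (rho g),
          gsource (sigma g) = grange (theta (gsource g)) &
          gmul (theta (grange g)) (rho g) = gmul (sigma g) (theta (gsource g))].

Definition homologically_similar (G H : etale_groupoid) : Prop :=
  exists (rho : gcar G -> gcar H) (sigma : gcar H -> gcar G),
    [/\ etale_homomorphism rho, etale_homomorphism sigma,
        similar (sigma \o rho) id & similar (rho \o sigma) id].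

(* ambient spaces of composable strings:
   strings1 k = G^{k+1} (product topology), i.e. G, G * G, G * (G * G), ...
   strings 0 = G^(0), strings (k+1) = strings1 k *)
Fixpoint strings1 (G : etale_groupoid) (k : nat) : topologicalType :=
  match k with
  | 0 => gcar G
  | S k' => ((gcar G * strings1 G k')%type : topologicalType)
  end.

Definition strings (G : etale_groupoid) (n : nat) : topologicalType :=
  match n with
  | 0 => gunit G
  | S k => strings1 G k
  end.

Definition shead (G : etale_groupoid) (k : nat) : strings1 G k -> gcar G :=
  match k return strings1 G k -> gcar G with
  | 0 => fun g => g
  | S _ => fun p => p.1
  end.

Fixpoint composable1 (G : etale_groupoid) (k : nat) : strings1 G k -> Prop :=
  match k return strings1 G k -> Prop with
  | 0 => fun _ => True
  | S k' => fun p => gsource p.1 = grange (shead p.2) /\ composable1 p.2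
  end.

Definition composable (G : etale_groupoid) (n : nat) : strings G n -> Prop :=
  match n return strings G n -> Prop with
  | 0 => fun _ => True
  | S k => @composable1 G k
  end.

(* face maps on (k+2)-strings (g_1, ..., g_{k+2}), i = 0..k+2:
   d_0 deletes the first entry, d_i (1 <= i <= k+1) replaces g_i, g_{i+1}
   by g_i g_{i+1}, d_{k+2} deletes the last entry. *)
Fixpoint face1 (G : etale_groupoid) (k : nat) :
    nat -> strings1 G k.+1 -> strings1 G k :=
  match k return nat -> strings1 G k.+1 -> strings1 G k with
  | 0 => fun i p => match i with
                    | 0 => p.2
                    | 1 => gmul p.1 p.2
                    | _ => p.1
                    end
  | S k' => fun i p =>
      match i with
      | 0 => p.2
      | 1 => (gmul p.1 p.2.1, p.2.2)
      | S j => (p.1, face1 j p.2)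
      end
  end.

(* face maps d_i : G^(n+1) -> G^(n).  For n = 0: d_0 = s, d_1 = r
   (so that delta_1 = s_push - r_push). *)
Definition face (G : etale_groupoid) (n : nat) :
    nat -> strings G n.+1 -> strings G n :=
  match n return nat -> strings G n.+1 -> strings G n with
  | 0 => fun i g => if i == 0%N then gsource g else grange g
  | S k => @face1 G k
  end.

Section Homology.
Variables (G : etale_groupoid) (A : topologicalZmodType).

Definition chain (n : nat) (f : strings G n -> A) : Prop :=
  [/\ {within composable (n:=n), continuous f},
      (forall x, ~ composable x -> f x = 0) &
      compact (closure [set x | composable x /\ f x != 0])].

Definition push (n : nat) (pi : strings G n.+1 -> strings G n)
    (f : strings G n.+1 -> A) : strings G n -> A :=
  fun y => \sum_(x \in [set x | composable x /\ pi x = y]) f x.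

Definition boundary (n : nat) (f : strings G n.+1 -> A) : strings G n -> A :=
  fun y => \sum_(i < n.+2) (push (@face G n i) f y) *~ ((-1) ^+ i).

(* ker delta_n (delta_0 = 0) *)
Definition cycles (n : nat) : set (strings G n -> A) :=
  match n return set (strings G n -> A) with
  | 0 => chain (n:=0)
  | S m => [set f | chain f /\ boundary f = 0]
  end.

Definition boundaries (n : nat) : set (strings G n -> A) :=
  [set f | exists2 g : strings G n.+1 -> A, chain g & boundary g = f].

End Homology.

(* Phi induces a group isomorphism Z1/B1 -> Z2/B2, [z] |-> [Phi z]
   (well defined additive map with kernel B1/B1, and surjective). *)
Definition quot_iso (V1 V2 : zmodType) (Z1 B1 : set V1) (Z2 B2 : set V2)
    (Phi : V1 -> V2) : Prop :=
  [/\ (forall z, Z1 z -> Z2 (Phi z)),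
      (forall z z', Z1 z -> Z1 z' -> B2 (Phi (z + z') - Phi z - Phi z')),
      (forall z, Z1 z -> (B2 (Phi z) <-> B1 z)) &
      (forall w, Z2 w -> exists2 z, Z1 z & B2 (Phi z - w))].

Definition homology_iso (G1 G2 : etale_groupoid) (A : topologicalZmodType)
    (n : nat) : Prop :=
  exists Phi : (strings G1 n -> A) -> (strings G2 n -> A),
    quot_iso (@cycles G1 A n) (@boundaries G1 A n)
             (@cycles G2 A n) (@boundaries G2 A n) Phi.

Definition Zdisc : Type := discrete_topology int.
HB.instance Definition _ := GRing.Zmodule.copy Zdisc int.
HB.instance Definition _ := Topological.copy Zdisc (discrete_topology int).

Lemma Zdisc_sub_continuous : continuous (fun x : Zdisc * Zdisc => x.1 - x.2).
Proof.
move=> [x y] U /= hU.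
exists ([set x], [set y]) => /=.
  by split; exact: discrete_set1.
by move=> [a b] [/= -> ->]; exact: nbhs_singleton hU.
Qed.

HB.instance Definition _ :=
  PreTopologicalNmodule_isTopologicalZmodule.Build Zdisc Zdisc_sub_continuous.

Definition nonneg_fun (T : Type) (f : T -> Zdisc) : Prop :=
  forall x, (0 <= (f x : int))%R.

(* H_0(G) = H_0(G, Z) with Z discrete.  There is an isomorphism
   pi : H_0(G1) -> H_0(G2) (induced by Phi) with pi(H_0(G1)^+) = H_0(G2)^+,
   where H_0(G)^+ = { [f] : f >= 0 }. *)
Definition H0_order_iso (G1 G2 : etale_groupoid) : Prop :=
  exists Phi : (strings G1 0 -> Zdisc) -> (strings G2 0 -> Zdisc),
    [/\ quot_iso (@cycles G1 Zdisc 0) (@boundaries G1 Zdisc 0)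
                 (@cycles G2 Zdisc 0) (@boundaries G2 Zdisc 0) Phi,
        (forall z, @cycles G1 Zdisc 0 z -> nonneg_fun z ->
           exists2 w, @cycles G2 Zdisc 0 w /\ nonneg_fun w &
                      @boundaries G2 Zdisc 0 (Phi z - w)) &
        (forall w, @cycles G2 Zdisc 0 w -> nonneg_fun w ->
           exists2 z, @cycles G1 Zdisc 0 z /\ nonneg_fun z &
                      @boundaries G2 Zdisc 0 (Phi z - w))].

(* Main.v *)
Require Import Defs.
From HB Require Import structures.
From mathcomp Require Import all_boot all_order all_algebra.
From mathcomp Require Import all_classical all_reals all_analysis.

Set Implicit Arguments.
Unset Strict Implicit.
Unset Printing Implicit Defensive.
Import Order.TTheory GRing.Theory Num.Theory.
Local Open Scope classical_set_scope.
Local Open Scope ring_scope.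

(* Since the unit space of G is compact and totally disconnected, a full clopen
   set Y admits a continuous section theta of the range map with source in Y,
   equal to the identity on Y.  Conjugation by theta is an étale homomorphism
   from G into G|Y, similar to the identity of G and equal to the identity on
   G|Y.  Composing these retractions for Y_1 and Y_2 with the isomorphism
   G_1|Y_1 = G_2|Y_2 and its inverse gives the homological similarity.

   Étale homomorphisms act on chains by summation over the fibers of the maps
   they induce on composable strings; all the maps involved (faces, induced
   maps, prism maps) are local homeomorphisms because they commute with the
   range of the first or the source of the last entry, up to a local
   homeomorphism of unit spaces.  A similarity with the identity yields the
   usual prism chain homotopy, so the induced maps in homology are mutually
   inverse, and in degree 0 they preserve nonnegative functions. *)

(** * Compactness and zero-dimensionality *)

(** If [P K] fails, the sets [A] for which [K] minus [A] satisfies [P] form a proper filter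
    containing [K]. At a cluster point, a neighbourhood [U] with [P U] has its complement in that
    filter, a contradiction. *)
Lemma compact_induction (T : topologicalType) (K : set T) (P : set T -> Prop) :
  compact K -> P set0 -> (forall A B, A `<=` B -> P B -> P A) ->
  (forall A B, P A -> P B -> P (A `|` B)) ->
  (forall x, K x -> exists2 U, nbhs x U & P U) -> P K.
Proof.
move=> Kc P0 Psub PU Ploc; apply: contrapT => nPK.
pose F : set_system T := [set A | P (K `\` A)].
have FF : ProperFilter F.
  split; first by rewrite /F /= setD0.
  split; first by rewrite /F /= setDT.
    by move=> A B FA FB; rewrite /F /= setDIr; exact: PU.
  by move=> A B AB; apply: Psub; exact: setDS.
have FK : F K by rewrite /F /= setDv.
have [x [Kx clx]] := Kc F FF FK.
have [U Ux PUU] := Ploc x Kx.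
have FU : F (~` U) by apply: Psub PUU; rewrite setDE setCK => z [].
by have [z []] := clx _ _ FU Ux.
Qed.

Lemma hausdorff_disjoint_nbhs (T : topologicalType) (x y : T) :
  hausdorff_space T -> x <> y ->
  exists A B, [/\ nbhs x A, nbhs y B & forall z, A z -> B z -> False].
Proof.
rewrite open_hausdorff => hT /eqP xy; have [[A B] /= [xA yB] [oA oB AB0]] := hT _ _ xy.
exists A, B; split.
- by apply: open_nbhs_nbhs; split => //; rewrite inE in xA.
- by apply: open_nbhs_nbhs; split => //; rewrite inE in yB.
- by move=> z Az Bz; move/eqP: AB0 => /seteqP[+ _] => /(_ z); apply.
Qed.

Lemma hausdorff_prod (T U : topologicalType) :
  hausdorff_space T -> hausdorff_space U -> hausdorff_space (T * U)%type.
Proof.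
move=> hT hU [a b] [c d] cl.
have [ac|nac] := pselect (a = c); have [bd|nbd] := pselect (b = d).
- by rewrite ac bd.
- have [A [B [Aa Bc AB]]] := hausdorff_disjoint_nbhs hU nbd.
  have [] := cl (setT `*` A) (setT `*` B).
  + by exists (setT, A) => //; split => //; exact: filterT.
  + by exists (setT, B) => //; split => //; exact: filterT.
  by move=> [z w] [[/= _ ?] [/= _ ?]]; case: (AB w).
- have [A [B [Aa Bc AB]]] := hausdorff_disjoint_nbhs hT nac.
  have [] := cl (A `*` setT) (B `*` setT).
  + by exists (A, setT) => //; split => //; exact: filterT.
  + by exists (B, setT) => //; split => //; exact: filterT.
  by move=> [z w] [[/= ? _] [/= ? _]]; case: (AB z).
- have [A [B [Aa Bc AB]]] := hausdorff_disjoint_nbhs hT nac.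
  have [] := cl (A `*` setT) (B `*` setT).
  + by exists (A, setT) => //; split => //; exact: filterT.
  + by exists (B, setT) => //; split => //; exact: filterT.
  by move=> [z w] [[/= ? _] [/= ? _]]; case: (AB z).
Qed.

(* The intersection Q of the clopen neighbourhoods of x is connected: a
   separation of Q extends to disjoint open sets U, V, and by compactness some
   clopen neighbourhood of x already lies in U `|` V. *)
Lemma totally_disconnected_zero_dimensional (T : topologicalType) :
  hausdorff_space T -> compact [set: T] -> totally_disconnected [set: T] ->
  zero_dimensional T.
Proof.
move=> hT cT tT x y xy; apply: contrapT => noU.
pose Q := [set z | forall D, clopen D -> D x -> D z].
have Qx : Q x by [].
have clQ : closed Q.
  have -> : Q = \bigcap_(D in [set D | clopen D /\ D x]) D.
    by apply/seteqP; split => z Qz D; [case; exact: Qz|move=> ? ?; exact: Qz].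
  by apply: closed_bigI => D [[]].
have Qy : Q y.
  by move=> D cD Dx; apply: contrapT => Dy; apply: noU; exists D.
suff Qc : connected Q.
  have : connected_component [set: T] x y by exists Q.
  by rewrite tT//= => yx; move: xy; rewrite yx eqxx.
move=> B [b Bb] [U0 oU0 BU0] [W0 cW0 BW0].
have cB : closed B by rewrite BW0; exact: closedI.
have cQB : closed (Q `\` B).
  suff -> : Q `\` B = Q `&` ~` U0 by apply: closedI => //; exact: open_closedC.
  apply/seteqP; split => z; rewrite BU0 => -[Qz h]; split => //; first by move=> ?; exact: h.
  by case.
have [U [V [oU oV BU QV UV]]] : exists U V, [/\ open U, open V, B `<=` U,
    Q `\` B `<=` V & forall z, U z -> V z -> False].
  have nB : set_nbhs B (~` (Q `\` B)).
    apply/set_nbhsP; exists (~` (Q `\` B)); split => //; first exact: closed_openC.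
    by move=> z Bz [].
  have [E /set_nbhsP[U [oU BU UE]] clE] := compact_normal hT cT cB nB.
  exists U, (~` closure E); split => //; first exact/closed_openC/closed_closure.
    by move=> z Qz /clE.
  by move=> z /UE /subset_closure.
have [D [cD Dx DUV]] : exists D, [/\ clopen D, D x & D `&` ~` (U `|` V) = set0].
  have cUV : compact (~` (U `|` V)).
    by apply: (subclosed_compact _ cT) => //; apply: open_closedC; exact: openU.
  apply: (@compact_induction T (~` (U `|` V))
    (fun A => exists D, [/\ clopen D, D x & D `&` A = set0]) cUV).
  - by exists setT; split => //; [exact: clopenT|rewrite setI0].
  - move=> A A' AA' [D [cD Dx D0]]; exists D; split => //.
    by apply: subsetI_eq0 D0.
  - move=> A A' [D [cD Dx D0]] [D' [cD' Dx' D0']]; exists (D `&` D'); split => //.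
      exact: clopenI.
    rewrite setIUr; apply/seteqP; split => // z [[[Dz _] Az]|[[_ Dz] Az]].
      by have : (D `&` A) z by []; rewrite D0.
    by have : (D' `&` A') z by []; rewrite D0'.
  - move=> z nUVz; have nQz : ~ Q z.
      move=> Qz; apply: nUVz; have [/BU|nBz] := pselect (B z); first by left.
      by right; apply: QV.
    have [D [cD Dx Dz]] : exists D, [/\ clopen D, D x & ~ D z].
      apply: contrapT => nD; apply: nQz => D cD Dx.
      by apply: contrapT => Dz; apply: nD; exists D.
    exists (~` D); last by exists D; rewrite setICr.
    by apply: open_nbhs_nbhs; split => //; apply: closed_openC; case: cD.
(* [U] and [V] are disjoint and cover [D], so each trace on [D] is the complement in [D] of the
   other, hence clopen; [Q] then lies in whichever trace contains [x]. *)
have clDU : clopen (D `&` U).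
  split; first by apply: openI => //; case: cD.
  suff -> : D `&` U = D `&` ~` V.
    by apply: closedI; [case: cD|exact: open_closedC].
  apply/seteqP; split => z [Dz h]; split => //; first by move=> /UV; apply.
  apply: contrapT => nU; have : (D `&` ~` (U `|` V)) z by split => // -[].
  by rewrite DUV.
have clDV : clopen (D `&` V).
  split; first by apply: openI => //; case: cD.
  suff -> : D `&` V = D `&` ~` U.
    by apply: closedI; [case: cD|exact: open_closedC].
  apply/seteqP; split => z [Dz h]; split => //; first by move=> /UV; apply.
  apply: contrapT => nU; have : (D `&` ~` (U `|` V)) z by split => // -[].
  by rewrite DUV.
have BQ : B `<=` Q by rewrite BU0 => z [].
have [Ux|nUx] := pselect (U x).
  apply/seteqP; split => // z Qz; apply: contrapT => nBz.
  have [_ Uz] : (D `&` U) z by apply: Qz.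
  by apply: (UV z) => //; apply: QV.
have Vx : V x by apply: QV; split => // /BU.
have [_ Vb] : (D `&` V) b by apply: BQ.
by case: (UV b) => //; exact: BU.
Qed.

(** * Relative local homeomorphisms *)

(* Says that pi restricts to a local homeomorphism from the subspace C to the
   subspace D; phrased with local inverses s and relative neighbourhoods so that
   no subspace has to be formed. *)
Definition etale_on (T U : topologicalType) (C : set T) (D : set U)
    (pi : T -> U) : Prop :=
  forall x, C x ->
  pi @ within C (nbhs x) --> within D (nbhs (pi x)) /\
  D (pi x) /\
  exists s : U -> T,
    [/\ s @ within D (nbhs (pi x)) --> within C (nbhs x),
        \forall y \near within D (nbhs (pi x)), pi (s y) = y &
        \forall z \near within C (nbhs x), s (pi z) = z].

Lemma within_at (T : topologicalType) (C : set T) (x : T) (P : set T) :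
  C x -> within C (nbhs x) P -> P x.
Proof. by move=> Cx /nbhs_singleton; apply. Qed.

Lemma cvg_to_within (T : Type) (U : topologicalType) (F : set_system T)
    {FF : Filter F} (D : set U) (f : T -> U) (y : U) :
  f @ F --> y -> F (f @^-1` D) -> f @ F --> within D (nbhs y).
Proof. by move=> fy fD P Py; apply: filterS2 fD (fy _ Py) => z Dz; apply. Qed.

Lemma cvg_from_within (T : Type) (U : topologicalType) (F : set_system T)
    (D : set U) (f : T -> U) (y : U) :
  f @ F --> within D (nbhs y) -> f @ F --> y.
Proof. by move=> fy P Py; apply: fy; exact: cvg_within. Qed.

Section EtaleOn.
Variables (T U V : topologicalType) (C : set T) (D : set U) (E : set V).

Lemma etale_on_comp (f : T -> U) (g : U -> V) :
  etale_on C D f -> etale_on D E g -> etale_on C E (g \o f).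
Proof.
move=> ef eg x Cx; have [cf [Dfx [s [cs fs sf]]]] := ef x Cx.
have [cg [Egx [t [ct gt tg]]]] := eg _ Dfx; split; last split => //.
  by move=> P /cg /cf.
exists (s \o t); split.
- by move=> P /cs /ct.
- by apply: filterS2 gt (ct _ fs) => y /= gty fsy; rewrite fsy.
- by apply: filterS2 sf (cf _ tg) => y /= sfy tgy; rewrite tgy.
Qed.

(** With [s] a local inverse of [p \o f], the local inverse of [f] is [s \o p]. This is the main way
    to show that a map is étale: compose it with a known étale map [p] and recognise the result. *)
Lemma etale_on_cancel (f : T -> U) (p : U -> V) :
  (forall x, C x -> D (f x)) ->
  {within C, continuous f} -> etale_on D E p -> etale_on C E (p \o f) ->
  etale_on C D f.
Proof.
move=> CD /subspace_continuousP cf ep epf x Cx.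
have [cp [Epx [t [ct pt tp]]]] := ep _ (CD _ Cx).
have [_ [_ [s [cs pfs spf]]]] := epf _ Cx.
have {}cf : f @ within C (nbhs x) --> within D (nbhs (f x)).
  by apply: cvg_to_within; [exact: cf|by apply: filterS (withinT _ _) => z; exact: CD].
split=> //; split; first exact: CD.
exists (s \o p); split.
- by move=> P /cs /cp.
(* [f (s (p y))] and [y] have the same image under [p], and both are near [f x], where [t] inverts
   [p]; so they agree. *)
- have h1 : \forall y \near within D (nbhs (f x)), p (f (s (p y))) = p y.
    exact: cp _ pfs.
  have h2 : \forall y \near within D (nbhs (f x)),
      t (p (f (s (p y)))) = f (s (p y)).
    exact: cp _ (cs _ (cf _ tp)).
  by apply: filterS3 h1 h2 tp => y h1 h2 h3; rewrite /= -h2 h1 h3.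
- by [].
Qed.

Lemma etale_on_eq (f g : T -> U) :
  (forall x, C x -> f x = g x) -> etale_on C D f -> etale_on C D g.
Proof.
move=> fg ef x Cx; have [cf [Dfx [s [cs fs sf]]]] := ef x Cx.
have Cn : within C (nbhs x) C by exact: withinT.
rewrite -fg//; split; last split => //.
  by move=> P /cf; apply: filterS2 Cn => z /= /fg ->.
exists s; split => //.
  have sC : \forall y \near within D (nbhs (f x)), C (s y) by exact: cs _ Cn.
  by apply: filterS2 sC fs => y /= /fg ->.
by apply: filterS2 Cn sf => z /= /fg ->.
Qed.

Lemma etale_on_continuous (f : T -> U) :
  etale_on C D f -> {within C, continuous f}.
Proof.
move=> ef; apply/subspace_continuousP => x Cx; have [cf _] := ef x Cx.
exact: cvg_from_within cf.
Qed.

Lemma etale_on_id : etale_on C C id.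
Proof. by move=> x Cx; split => //; split => //; exists id; split => //; exact: nearW. Qed.

End EtaleOn.

Lemma inverse_etale_on (T U : topologicalType) (C : set T) (D : set U)
    (f : T -> U) (g : U -> T) :
  (forall x, C x -> D (f x)) -> (forall y, D y -> C (g y)) ->
  (forall x, C x -> g (f x) = x) -> (forall y, D y -> f (g y) = y) ->
  {within C, continuous f} -> {within D, continuous g} -> etale_on C D f.
Proof.
move=> CD DC gf fg /subspace_continuousP cf /subspace_continuousP cg x Cx.
split.
  apply: cvg_to_within; first exact: cf.
  by apply: filterS (withinT _ _) => z; exact: CD.
split; first exact: CD.
exists g; split.
- have := cg _ (CD _ Cx); rewrite /from_subspace gf// => cgx.
  apply: cvg_to_within; first exact: cgx.
  by apply: filterS (withinT _ _) => z; exact: DC.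
- by apply: filterS (withinT _ _) => z; exact: fg.
- by apply: filterS (withinT _ _) => z; exact: gf.
Qed.

(** At a point of the open set [D] the relative and the full neighbourhood filters coincide. *)
Lemma etale_on_openr (T U : topologicalType) (C : set T) (D : set U)
    (f : T -> U) : open D -> etale_on C D f -> etale_on C setT f.
Proof.
move=> oD ef x Cx; have := ef x Cx; rewrite withinET (@within_interior _ D).
  by move=> [? [_ ?]].
by rewrite ((interior_id _).1 oD); have [_ []] := ef x Cx.
Qed.

Lemma etale_on_restrictr (T U : topologicalType) (C : set T) (D : set U)
    (f : T -> U) : open D -> (forall x, C x -> D (f x)) ->
  etale_on C setT f -> etale_on C D f.
Proof.
move=> oD CD ef x Cx; have Dfx := CD x Cx; have := ef x Cx.
rewrite withinET (@within_interior _ D); first by move=> [? [_ ?]].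
by rewrite ((interior_id _).1 oD).
Qed.

(** Unlike in [etale_on], one section is continuous at every point of an open set, as the gluing of
    sections of the range map requires. *)
Lemma local_homeo_section (T U : topologicalType) (f : T -> U) :
  local_homeo f -> forall x, exists (W : set U) (s : U -> T),
  [/\ open W, W (f x), (forall y, W y -> s @ y --> s y /\ f (s y) = y) &
      \forall z \near x, s (f z) = z].
Proof.
move=> [cf lf] x; have [B0 [oO Ox injf opf]] := lf x.
(* The value [x] off the image is a default that makes the choice function total. *)
have Ws y : exists z, (f @` B0) y -> B0 z /\ f z = y.
  have [[z Oz <-]|nO] := pselect ((f @` B0) y); first by exists z.
  by exists x.
have [s sP] := choice Ws.
have sf z : B0 z -> s (f z) = z.
  move=> Oz; have [Osz fsz] : B0 (s (f z)) /\ f (s (f z)) = f z.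
    by apply: sP; exists z.
  by apply: injf; rewrite ?inE.
exists (f @` B0), s; split.
- exact: opf.
- by exists x.
- move=> _ [z Oz <-]; rewrite sf//; split => // P.
  rewrite nbhsE => -[B [oB Bz] BP].
  have : open_nbhs (f z) (f @` (B `&` B0)).
    split; last by exists z.
    by apply: opf; [exact: openI|move=> ? []].
  move=> /open_nbhs_nbhs; apply: filterS => _ [w [Bw Ow] <-] /=.
  by rewrite sf//; exact: BP.
- suff : \forall z \near x, B0 z by apply: filterS => z; exact: sf.
  exact: open_nbhs_nbhs.
Qed.

Lemma local_homeo_etale (T U : topologicalType) (f : T -> U) :
  local_homeo f <-> etale_on setT setT f.
Proof.
split=> [lf x _|ef].
  rewrite !withinET; split; first by case: lf => cf _; exact: cf.
  split => //; have [W [s [oW Wfx sW sf]]] := local_homeo_section lf x.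
  exists s; split => //.
    by have [+ _] := sW _ Wfx; rewrite (nbhs_singleton sf).
  suff : \forall y \near f x, W y by apply: filterS => y /sW[].
  exact: open_nbhs_nbhs.
split=> [x|x]; first by have [] := ef x I; rewrite !withinET.
have [_ [_ [s [_ _]]]] := ef x I; rewrite withinET => sf.
(* The equation [s (f z) = z] forces injectivity on this interior. *)
exists (interior [set z | s (f z) = z]); split.
- exact: open_interior.
- exact: sf.
- by move=> y z /set_mem/interior_subset /= sy /set_mem/interior_subset /= sz fyz;
    rewrite -sy fyz sz.
(* Openness at [f z] comes from a local inverse [t] taken at [z] itself, which maps points near
   [f z] into [B]. *)
- move=> B oB _; rewrite openE => _ [z Bz <-].
  have [_ [_ [t [+ + _]]]] := ef z I; rewrite !withinET => ct ft.
  have Bn : \forall y \near f z, B (t y).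
    by apply: ct; exact: open_nbhs_nbhs.
  by apply: filterS2 Bn ft => y By fty; exists (t y).
Qed.

(** * Compactly supported functions and pushforward *)

(** Subspaces are encoded by predicates, with functions extended by zero off [C]. On composable
    strings [cc] unfolds to [chain], and [fiber_sum] below to [push]. *)
Definition cc (T : topologicalType) (A : topologicalZmodType) (C : set T)
    (f : T -> A) : Prop :=
  [/\ {within C, continuous f}, (forall x, ~ C x -> f x = 0) &
      compact (closure [set x | C x /\ f x != 0])].

Definition fiber_sum (T U : topologicalType) (A : topologicalZmodType)
    (C : set T) (pi : T -> U) (f : T -> A) : U -> A :=
  fun y => \sum_(x \in [set x | C x /\ pi x = y]) f x.

Lemma near_all_seq (T : Type) (I : eqType) (F : set_system T) {FF : Filter F}
    (r : seq I) (P : I -> T -> Prop) :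
  (forall i, i \in r -> \forall x \near F, P i x) ->
  \forall x \near F, forall i, i \in r -> P i x.
Proof.
elim: r => [_|i r ih h]; first by apply: filterE => x i.
have ir : i \in i :: r by rewrite inE eqxx.
apply: filterS2 (h i ir) (ih _) => [x Pi Pr j|j jr].
  by rewrite inE => /orP[/eqP ->//|/Pr].
by apply: h; rewrite inE jr orbT.
Qed.

Section FiberSum.
Variables (T U : topologicalType) (A : topologicalZmodType).
Variables (C : set T) (D : set U) (pi : T -> U).
Hypotheses (hT : hausdorff_space T) (hU : hausdorff_space U) (cC : closed C).
Hypothesis epi : etale_on C D pi.

Let is_section (y : U) (x : T) (s : U -> T) :=
  [/\ s @ within D (nbhs y) --> within C (nbhs x),
      \forall y' \near within D (nbhs y), pi (s y') = y' & s y = x].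

(** Compact induction on [K]. Near a point of the fiber over [y], the local inverse there recovers
    every point of [C] from its image; near any other point of [K] the images stay away from [y],
    and the empty list works. *)
Lemma fiber_sections (K : set T) (y : U) : compact K -> K `<=` C ->
  exists (r : seq T) (S : T -> U -> T),
  [/\ uniq r, (forall x, x \in r -> C x /\ pi x = y),
      (forall x, x \in r -> is_section y x (S x)) &
      \forall y' \near within D (nbhs y), forall x, K x -> pi x = y' ->
        exists2 z, z \in r & x = S z y'].
Proof.
move=> cK KC.
have /choice[S SP] : forall x, exists s : U -> T, C x ->
    is_section (pi x) x s /\ \forall z \near within C (nbhs x), s (pi z) = z.
  move=> x; have [Cx|nCx] := pselect (C x); last by exists (fun=> x).
  have [_ [_ [s [cs pis spi]]]] := epi Cx.
  by exists s => _; do !split => //; exact: (within_at Cx spi).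
have [r [rP rK]] : exists r : seq T, (forall x, x \in r -> C x /\ pi x = y) /\
    \forall y' \near within D (nbhs y), forall x, (K `&` C) x -> pi x = y' ->
        exists2 z, z \in r & x = S z y'.
  apply: (@compact_induction T K (fun B => exists r : seq T,
     (forall x, x \in r -> C x /\ pi x = y) /\
     \forall y' \near within D (nbhs y), forall x, (B `&` C) x -> pi x = y' ->
        exists2 z, z \in r & x = S z y')).
  - exact: cK.
  - by exists [::]; split=> //; apply: filterE => y' x [].
  - move=> B B' BB' [r [rP rB]]; exists r; split=> //.
    by apply: filterS rB => y' h x [/BB' ? ?]; apply: h.
  - move=> B B' [r [rP rB]] [r' [rP' rB']]; exists (r ++ r'); split=> [x|].
      by rewrite mem_cat => /orP[/rP|/rP'].
    apply: filterS2 rB rB' => y' h h' x [[Bx|Bx] Cx] /[dup] pix.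
      by move=> /h[]// z zr ->; exists z => //; rewrite mem_cat zr.
    by move=> /h'[]// z zr ->; exists z => //; rewrite mem_cat zr orbT.
  - move=> x Kx; have Cx := KC _ Kx; have [pixy|npixy] := pselect (pi x = y).
      have [_ near_x] := SP x Cx.
      exists [set z | C z -> S x (pi z) = z] => //.
      exists [:: x]; split=> [z|]; first by rewrite inE => /eqP ->.
      apply: filterE => y' z [+ Cz] <- => /(_ Cz) sz.
      by exists x; rewrite ?inE.
    have [B [B' [Bx By BB']]] := hausdorff_disjoint_nbhs hU npixy.
    have [/cvg_from_within cpi _] := epi Cx.
    exists [set z | C z -> B (pi z)]; first exact: cpi _ Bx.
    exists [::]; split=> //; apply: filterS (cvg_within D By) => y' By' z /= [+ Cz] zy'.
    by move=> /= /(_ Cz); rewrite zy' => /BB'; case/(_ By').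
(* Repetitions are removed so that no preimage is counted twice. *)
exists (undup r), S; split.
- exact: undup_uniq.
- by move=> x; rewrite mem_undup; exact: rP.
- by move=> x; rewrite mem_undup => /rP[Cx <-]; case: (SP x Cx).
- apply: filterS rK => y' h x Kx /h[]; first by split=> //; exact: KC.
  by move=> z zr ->; exists z => //; rewrite mem_undup.
Qed.

Variable f : T -> A.
Hypothesis ccf : cc C f.

Let K := closure [set x | C x /\ f x != 0].

Let KC : K `<=` C.
Proof. by rewrite [X in _ `<=` X]((closure_id C).1 cC); apply: closureS => x []. Qed.

Let fK x : C x -> ~ K x -> f x = 0.
Proof.
move=> Cx nKx; apply/eqP; apply: contra_notT nKx => fx.
by apply: subset_closure; split.
Qed.

Let cK : compact K. Proof. by case: ccf. Qed.

(** Turns the fiber sum into a finite sum along sections with a limit at [y], from which its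
    continuity follows. *)
Lemma fiber_sum_local (y : U) : D y -> exists (r : seq T) (S : T -> U -> T),
  [/\ (forall x, x \in r -> C x),
      (forall x, x \in r -> is_section y x (S x)) &
      \forall y' \near within D (nbhs y),
        fiber_sum C pi f y' = \sum_(x <- r) f (S x y')].
Proof.
move=> Dy; have [r [S [ur rP rS rK]]] := fiber_sections y cK KC.
exists r, S; split=> // [x /rP[]//|].
have SC : \forall y' \near within D (nbhs y), forall x, x \in r ->
    C (S x y') /\ pi (S x y') = y'.
  apply: near_all_seq => x /rS[cS pS _].
  have : \forall y' \near within D (nbhs y), C (S x y').
    by apply: cS; exact: withinT.
  by apply: filterS2 pS => ? ->.
(* Distinct points of the fiber are separated in [T], so their sections have distinct values near
   [y]. *)
have Sinj : \forall y' \near within D (nbhs y), forall x, x \in r ->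
    forall z, z \in r -> S x y' = S z y' -> x = z.
  apply: near_all_seq => x xr; apply: near_all_seq => z zr.
  have [->|nxz] := pselect (x = z); first exact: filterE.
  have [B [B' [Bx Bz BB']]] := hausdorff_disjoint_nbhs hT nxz.
  have [/cvg_from_within cSx _ _] := rS x xr.
  have [/cvg_from_within cSz _ _] := rS z zr.
  have hx : \forall y' \near within D (nbhs y), B (S x y') by exact: cSx _ Bx.
  have hz : \forall y' \near within D (nbhs y), B' (S z y') by exact: cSz _ Bz.
  apply: filterS2 hx hz => y' /= Bx' Bz' e.
  by case: (BB' _ Bx'); rewrite e.
apply: filterS3 SC Sinj rK => y' SC Sinj rK.
rewrite /fiber_sum (fsbigE [seq S x y' | x <- r]).
- rewrite big_map big_seq_cond [RHS]big_seq_cond; apply: eq_bigl => x.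
  by case xr: (x \in r) => //=; have := SC x xr => h; rewrite mem_set.
- by rewrite map_inj_in_uniq// => x z xr zr; exact: Sinj.
- by move=> _ /= /mapP[x xr ->]; exact: SC.
(* A preimage that no section reaches is outside [K], where [f] vanishes. *)
- move=> x [Cx pix] /mapP nx; apply: fK => // Kx; apply: nx.
  by have [z zr ->] := rK x Kx pix; exists z.
Qed.

(** A sum over a set is zero by default when its support is infinite; this finiteness makes
    [fiber_sum] the intended sum. It follows by evaluating [fiber_sections] at [y] itself. *)
Lemma fiber_sum_fiber_finite (y : U) :
  finite_set [set x | [/\ C x, pi x = y & f x != 0]].
Proof.
have [Dy|nDy] := pselect (D y); last first.
  suff -> : [set x | [/\ C x, pi x = y & f x != 0]] = set0 by exact: finite_set0.
  apply/seteqP; split=> // x [Cx pix _]; apply: nDy; rewrite -pix.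
  by have [_ []] := epi Cx.
have [r [S [ur rP rS rK]]] := fiber_sections y cK KC.
apply: (@sub_finite_set _ _ [set` r]); last exact: finite_seq.
move=> x [Cx pix fx] /=; have Kx : K x by apply: subset_closure.
have [z zr ->] := within_at Dy rK x Kx pix.
by have [_ _ ->] := rS z zr.
Qed.

(** Continuity is local, by [fiber_sum_local]. The support lies in the image of [K], which is
    compact and hence closed in the Hausdorff space [U]. *)
Lemma fiber_sum_cc : cc D (fiber_sum C pi f).
Proof.
have piD x : C x -> D (pi x) by move=> Cx; have [_ []] := epi Cx.
have [/subspace_continuousP cf f0 _] := ccf.
have nz y : fiber_sum C pi f y != 0 -> exists x, [/\ C x, K x & pi x = y].
  move=> /(@fsbigN1 _ _ _ unit _ _ (fun=> f) tt)[x [Cx pix] fx].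
  by exists x; split=> //; apply: contrapT => /fK; move=> /(_ Cx); exact/eqP.
split.
- apply/subspace_continuousP => y Dy.
  have [r [S [rC rS push]]] := fiber_sum_local Dy.
  have /= E := within_at Dy push.
  have cS : (fun y' => \sum_(x <- r | x \in r) f (S x y')) @ within D (nbhs y) -->
      \sum_(x <- r | x \in r) f (S x y).
    apply: (cvg_big (@add_continuous A)) => x xr; have [cS _ ->] := rS x xr.
    by move=> P /(cf _ (rC x xr)) /cS.
  move=> P nP.
  have {nP} /cS : nbhs (\sum_(x <- r | x \in r) f (S x y)) P.
    by rewrite -big_seq -E; exact: nP.
  apply: filterS2 push => y' e; rewrite /preimage /= -big_seq -e; exact: id.
- move=> y nDy; rewrite /fiber_sum fsbig1// => x [/piD + pix].
  by rewrite pix.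
- have cpK : compact (pi @` K).
    apply: continuous_compact => //.
    by apply: continuous_subspaceW KC (etale_on_continuous epi).
  apply: (subclosed_compact _ cpK); first exact: closed_closure.
  rewrite [X in _ `<=` X]((closure_id _).1 (compact_closed hU cpK)).
  by apply: closureS => y [_ /nz[x [_ Kx <-]]]; exists x.
Qed.

End FiberSum.

(** Any duplicate-free list that contains the support may index the sum, so several sums can share
    one list. *)
Lemma fsum_seq (I : choiceType) (A : zmodType) (s : seq I) (P : set I)
    (f : I -> A) :
  uniq s -> (forall i, P i -> i \notin s -> f i = 0) ->
  \sum_(i \in P) f i = \sum_(i <- s | i \in P) f i.
Proof.
move=> us f0; rewrite [RHS]bigfs ?set_mem_set//=.
by move=> i; rewrite inE; apply: f0.
Qed.

(** * The group of compactly supported functions; linearity and functoriality of fiber sums *)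

Section CcGroup.
Variables (T : topologicalType) (A : topologicalZmodType) (C : set T).
Implicit Types f g : T -> A.

Lemma cc0 : cc C (0 : T -> A).
Proof.
split=> //.
  by apply/subspace_continuousP => x _; exact: cvg_cst.
suff -> : [set x | C x /\ (0 : T -> A) x != 0] = set0.
  by rewrite closure0; exact: compact0.
by apply/seteqP; split=> // x [_ /=]; rewrite eqxx.
Qed.

Lemma ccN f : cc C f -> cc C (- f).
Proof.
move=> [/subspace_continuousP cf f0 Kf]; split.
- apply/subspace_continuousP => x Cx P Px.
  have : f @ within C (nbhs x) --> f x by exact: cf.
  move=> /(continuous_cvg _ (@opp_continuous A (f x))); apply; exact: Px.
- by move=> x nCx; rewrite /GRing.opp /= f0// oppr0.
- suff -> : [set x | C x /\ (- f) x != 0] = [set x | C x /\ f x != 0] by [].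
  by apply/seteqP; split=> x [Cx]; rewrite /GRing.opp /= oppr_eq0.
Qed.

Lemma ccD f g : cc C f -> cc C g -> cc C (f + g).
Proof.
move=> [/subspace_continuousP cf f0 Kf] [/subspace_continuousP cg g0 Kg]; split.
- apply/subspace_continuousP => x Cx P Px.
  have := continuous2_cvg _ (@add_continuous A (f x, g x)) (cf x Cx) (cg x Cx).
  by apply; exact: Px.
- by move=> x nCx; rewrite /GRing.add /= f0// g0// addr0.
- apply: (subclosed_compact _ (compactU Kf Kg)); first exact: closed_closure.
  rewrite -closureU; apply: closureS => x [Cx].
  have [fx|fx] := eqVneq (f x) 0; last by left.
  by rewrite {1}/GRing.add /= fx add0r; right.
Qed.

Lemma ccB f g : cc C f -> cc C g -> cc C (f - g).
Proof. by move=> cf cg; apply: ccD => //; exact: ccN. Qed.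

Lemma cc_signed f i : cc C f -> cc C (f *~ (-1) ^+ i).
Proof.
move=> cf; rewrite -signr_odd; case: (odd i); rewrite ?expr1 ?expr0 ?mulr1z//.
by rewrite mulrN1z; exact: ccN.
Qed.

Lemma cc_sum (I : Type) (r : seq I) (P : pred I) (F : I -> T -> A) :
  (forall i, P i -> cc C (F i)) -> cc C (\sum_(i <- r | P i) F i).
Proof. by move=> h; elim/big_ind: _ => //; [exact: cc0|exact: ccD]. Qed.

End CcGroup.

Lemma fiber_sum_eq (T U : topologicalType) (A : topologicalZmodType)
    (C : set T) (pi pi' : T -> U) (f : T -> A) :
  (forall x, C x -> pi x = pi' x) -> fiber_sum C pi f = fiber_sum C pi' f.
Proof.
move=> e; apply/funext => y; apply: eq_fsbigl.
by apply/seteqP; split=> x /= [Cx <-]; split=> //; rewrite e.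
Qed.

Lemma fiber_sum_id (T : topologicalType) (A : topologicalZmodType)
    (C : set T) (f : T -> A) :
  (forall x, ~ C x -> f x = 0) -> fiber_sum C id f = f.
Proof.
move=> f0; apply/funext => y; rewrite /fiber_sum.
have [Cy|nCy] := pselect (C y).
  rewrite -[RHS](@fsbig_set1 _ _ +%R _ y f); apply: eq_fsbigl.
  by apply/seteqP; split=> [x []//|_ ->].
by rewrite f0// fsbig1// => x [Cx /= xy]; case: nCy; rewrite -xy.
Qed.

(** Summation in stages over the fiber of [q \o p] at [z]. That fiber meets the nonzero set of [f]
    in a finite list [s], over which both sides are rewritten. *)
Lemma fiber_sum_comp (T U V : topologicalType) (A : topologicalZmodType)
    (C : set T) (D : set U) (E : set V) (f : T -> A) (p : T -> U) (q : U -> V) :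
  hausdorff_space V -> closed C ->
  etale_on C D p -> etale_on D E q -> cc C f ->
  fiber_sum D q (fiber_sum C p f) = fiber_sum C (q \o p) f.
Proof.
move=> hV cC ep eq ccf; apply/funext => z.
have pD x : C x -> D (p x) by move=> Cx; have [_ []] := ep x Cx.
have finS := fiber_sum_fiber_finite hV cC (etale_on_comp ep eq) ccf z.
have [s us sE] : exists2 s : seq T, uniq s &
    forall x, (x \in s) = `[<[/\ C x, q (p x) = z & f x != 0]>].
  have [s sE] := (finite_seqP _).1 finS; exists (undup s); first exact: undup_uniq.
  move=> x; rewrite mem_undup; apply/idP/asboolP => [xs|h].
    by have : [set` s] x by []; rewrite -sE.
  by have : [set x | [/\ C x, (q \o p) x = z & f x != 0]] x by []; rewrite sE.
(* For every [y] over [z] the same list [s] serves, cut down by [p x == y]. *)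
have inner y : q y = z ->
    fiber_sum C p f y = \sum_(x <- s | p x == y) f x.
  move=> qy; rewrite /fiber_sum (fsum_seq us).
    rewrite big_seq_cond [RHS]big_seq_cond; apply: eq_bigl => x.
    case xs : (x \in s) => //=; move: xs; rewrite sE => /asboolP[Cx _ _].
    by apply/idP/eqP => [/set_mem[]//|pxy]; rewrite inE.
  move=> x [Cx pxy] xs; apply/eqP; apply: contraNT xs => fx.
  by rewrite sE; apply/asboolP; split=> //; rewrite pxy.
(* The outer sum runs over the images of [s]; at any other [y] over [z] the inner sum is empty. *)
rewrite {1}/fiber_sum (fsum_seq (undup_uniq (map p s))); last first.
  move=> y [Dy qy] ys; rewrite inner//; apply: big1_seq => x /andP[/eqP pxy xs].
  by case/negP: ys; rewrite mem_undup; apply/mapP; exists x.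
rewrite [RHS]/fiber_sum (fsum_seq us); last first.
  move=> x [Cx pxy] xs; apply/eqP; apply: contraNT xs => fx.
  by rewrite sE; apply/asboolP; split.
transitivity (\sum_(y <- undup (map p s)) \sum_(x <- s | p x == y) f x).
  rewrite big_seq_cond [RHS]big_seq_cond; apply: eq_big => y.
    rewrite andbT; case ys: (y \in undup _) => //=; apply: mem_set.
    move: ys; rewrite mem_undup => /mapP[x + ->]; rewrite sE => /asboolP[Cx qx _].
    by split=> //; exact: pD.
  by move=> /andP[_ /set_mem[_ /inner]].
transitivity (\sum_(x <- s) f x); last first.
  rewrite big_seq_cond [RHS]big_seq_cond; apply: eq_bigl => x.
  case xs: (x \in s) => //=; apply/esym/mem_set; move: xs; rewrite sE => /asboolP[Cx qx _].
  by split.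
(* After the exchange each [x] contributes once, at [y = p x]. *)
under eq_bigr do rewrite big_mkcond; rewrite exchange_big /=.
apply: eq_big_seq => x xs.
rewrite (bigD1_seq (p x)) ?undup_uniq//=; last by rewrite mem_undup map_f.
by rewrite eqxx big1 ?addr0// => y; rewrite eq_sym => /negPf ->.
Qed.

Section FiberSumAdditive.
Variables (T U : topologicalType) (A : topologicalZmodType).
Variables (C : set T) (D : set U) (pi : T -> U).
Hypotheses (hU : hausdorff_space U) (cC : closed C) (epi : etale_on C D pi).
Implicit Types f g : T -> A.

(** Both supports in the fiber are finite, so one list [s] indexes the sums of [f], [g] and
    [f + g]. *)
Lemma fiber_sumD f g : cc C f -> cc C g ->
  fiber_sum C pi (f + g) = fiber_sum C pi f + fiber_sum C pi g.
Proof.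
move=> cf cg; apply/funext => y.
pose S h : set T := [set x | [/\ C x, pi x = y & h x != 0 :> A]].
have fin : finite_set (S f `|` S g).
  by rewrite finite_setU; split; exact: (fiber_sum_fiber_finite hU cC epi).
have [s sE] := (finite_seqP _).1 fin.
have nS h : S h `<=` [set` s] -> fiber_sum C pi h y =
    \sum_(i <- undup s | i \in [set x | C x /\ pi x = y]) h i.
  move=> hs; apply: fsum_seq; first exact: undup_uniq.
  move=> x [Cx pix]; rewrite mem_undup => /negP xs; apply/eqP.
  by apply: contra_notT xs => hx; apply: hs; split.
have Sf : S f `<=` [set` s] by rewrite -sE => x; left.
have Sg : S g `<=` [set` s] by rewrite -sE => x; right.
have Sfg : S (f + g) `<=` [set` s].
  rewrite -sE => x [Cx pix]; rewrite {1}/GRing.add /=.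
  have [fx|fx] := eqVneq (f x) 0; last by left.
  by rewrite fx add0r; right.
by rewrite [RHS]/GRing.add /= (nS _ Sf) (nS _ Sg) (nS _ Sfg) big_split.
Qed.

(** [f] and its opposite have the same support, hence the same index list. *)
Lemma fiber_sumN f : fiber_sum C pi (- f) = - fiber_sum C pi f.
Proof.
apply/funext => y; rewrite [RHS]/GRing.opp /= /fiber_sum -sumrN.
suff -> : finite_support 0 [set x | C x /\ pi x = y] (- f) =
    finite_support 0 [set x | C x /\ pi x = y] f by [].
rewrite /finite_support !unlock.
suff -> : (- f) @^-1` [set~ 0] = f @^-1` [set~ 0] by [].
by apply/seteqP; split=> x /= /eqP fx; apply/eqP; move: fx; rewrite oppr_eq0.
Qed.

Lemma fiber_sum0 : fiber_sum C pi (0 : T -> A) = 0.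
Proof. by apply/funext => y; rewrite /fiber_sum fsbig1. Qed.

Lemma fiber_sum_signed f i :
  fiber_sum C pi (f *~ (-1) ^+ i) = fiber_sum C pi f *~ (-1) ^+ i.
Proof.
rewrite -signr_odd; case: (odd i); rewrite ?expr1 ?expr0 ?mulr1z//.
by rewrite !mulrN1z fiber_sumN.
Qed.

Lemma fiber_sum_sum (I : Type) (r : seq I) (F : I -> T -> A) :
  (forall i, cc C (F i)) ->
  fiber_sum C pi (\sum_(i <- r) F i) = \sum_(i <- r) fiber_sum C pi (F i).
Proof.
move=> cF; elim: r => [|i r ih]; first by rewrite !big_nil fiber_sum0.
by rewrite !big_cons fiber_sumD// ?ih//; exact: cc_sum.
Qed.

End FiberSumAdditive.

Lemma closed_equalizer (T U : topologicalType) (f g : T -> U) :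
  hausdorff_space U -> continuous f -> continuous g ->
  closed [set x | f x = g x].
Proof.
move=> hU cf cg x clx; apply: contrapT => nfg.
have [A [B [Af Bg AB]]] := hausdorff_disjoint_nbhs hU nfg.
have nx : nbhs x (f @^-1` A `&` g @^-1` B).
  by apply: filterI; [exact: cf|exact: cg].
by have [z [/= fgz [Az Bz]]] := clx _ nx; apply: (AB (f z)) => //; rewrite fgz.
Qed.

(** * Structure maps of an étale groupoid *)

Section GroupoidBasics.
Variable G : etale_groupoid.
Implicit Types g h : gcar G.

Lemma ginvK g : ginv (ginv g) = g.
Proof.
rewrite -[LHS]gmul_id gsource_inv grange_inv -gmulVl -gmulA ?gsource_inv ?grange_inv//.
by rewrite gmulVl gsource_inv gid_mul.
Qed.

Lemma grange_etale_on : etale_on setT setT (@grange G).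
Proof. by apply/local_homeo_etale; exact: grange_etale. Qed.

Lemma grange_continuous : continuous (@grange G).
Proof. by have [] := grange_etale G. Qed.

Lemma ginv_etale_on : etale_on setT setT (@ginv G).
Proof.
move=> g _; rewrite !withinET; split; first exact: ginv_cont.
split=> //; exists ginv; split.
- by have := @ginv_cont G (ginv g); rewrite /continuous_at ginvK.
- by apply: nearW => h; rewrite ginvK.
- by apply: nearW => h; rewrite ginvK.
Qed.

Lemma gsource_etale_on : etale_on setT setT (@gsource G).
Proof.
apply: etale_on_eq (etale_on_comp ginv_etale_on grange_etale_on) => g _.
exact: grange_inv.
Qed.

(** Cancellation against the étale map [grange], as [grange \o t] is the identity. *)
Lemma grange_section_etale_on (t : gunit G -> gcar G) :
  continuous t -> (forall x, grange (t x) = x) -> etale_on setT setT t.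
Proof.
move=> ct rt; apply: etale_on_cancel grange_etale_on _ => //.
  exact/continuous_subspaceT.
by apply: etale_on_eq (@etale_on_id _ setT) => x _; rewrite /= rt.
Qed.

Lemma gid_etale_on : etale_on setT setT (@gid G).
Proof. by apply: grange_section_etale_on; [exact: gid_cont|exact: grange_id]. Qed.

Lemma cvg_gmul (T : Type) (F : set_system T) {FF : Filter F} (u v : T -> gcar G) g h :
  gsource g = grange h -> (\forall x \near F, gsource (u x) = grange (v x)) ->
  u @ F --> g -> v @ F --> h -> (fun x => gmul (u x) (v x)) @ F --> gmul g h.
Proof.
move=> gh uv cu cv P nP.
have /subspace_continuousP/(_ (g, h) gh P nP) := @gmul_cont G.
have cuv : (fun x => (u x, v x)) @ F --> within
    [set p : gcar G * gcar G | gsource p.1 = grange p.2] (nbhs (g, h)).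
  by apply: cvg_to_within => //; exact: cvg_pair.
by move/cuv.
Qed.

Lemma gmul_inj_r g h h' : gsource g = grange h -> gsource g = grange h' ->
  gmul g h = gmul g h' -> h = h'.
Proof.
move=> gh gh' e; rewrite -[h]gid_mul -[h']gid_mul -gh -gh' -gmulVl.
by rewrite !gmulA ?gsource_inv// e.
Qed.

End GroupoidBasics.

(** * Composable strings *)

Section Strings.
Variable G : etale_groupoid.

Lemma strings1_hausdorff k : hausdorff_space (strings1 G k).
Proof.
by elim: k => [|k ih]; [exact: gcar_hausdorff|exact: hausdorff_prod (@gcar_hausdorff G) ih].
Qed.

Lemma strings_hausdorff n : hausdorff_space (strings G n).
Proof. by case: n => [|k]; [exact: gunit_hausdorff|exact: strings1_hausdorff]. Qed.

Lemma shead_continuous k : continuous (@shead G k).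
Proof. by case: k => [|k] x; [exact: cvg_id|exact: cvg_fst]. Qed.

Lemma fst_strings_continuous k : continuous (fun p : strings1 G k.+1 => p.1).
Proof. by move=> p; exact: cvg_fst. Qed.

Lemma snd_strings_continuous k : continuous (fun p : strings1 G k.+1 => p.2).
Proof. by move=> p; exact: cvg_snd. Qed.

Lemma composable1_closed k : closed (@composable1 G k).
Proof.
elim: k => [|k ih]; first exact: closedT.
apply: (@closedI _ [set p : strings1 G k.+1 | gsource p.1 = grange (shead p.2)]
  [set p | composable1 p.2]).
  apply: closed_equalizer; first exact: gunit_hausdorff.
    by move=> p; apply: continuous_comp; [exact: cvg_fst|exact: gsource_cont].
  move=> p P /(@grange_continuous G) /(@shead_continuous k).
  by move=> /(@snd_strings_continuous k).
exact: ((continuous_closedP _).1 (@snd_strings_continuous k)).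
Qed.

Lemma composable_closed n : closed (@composable G n).
Proof. by case: n => [|k]; [exact: closedT|exact: composable1_closed]. Qed.

Lemma cvg_fst_composable k (p : strings1 G k.+1) :
  fst @ within (@composable1 G k.+1) (nbhs p) --> p.1.
Proof. by apply: cvg_within_filter; exact: fst_strings_continuous. Qed.

Lemma cvg_snd_composable k (p : strings1 G k.+1) :
  snd @ within (@composable1 G k.+1) (nbhs p) --> within (@composable1 G k) (nbhs p.2).
Proof.
apply: cvg_to_within; first by apply: cvg_within_filter; exact: snd_strings_continuous.
by apply: filterS (withinT _ _) => q [].
Qed.

Definition rhead k (w : strings1 G k) : gunit G := grange (shead w).

Fixpoint slast k : strings1 G k -> gunit G :=
  match k return strings1 G k -> gunit G with
  | 0 => gsource
  | S _ => fun p => slast p.2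
  end.

Lemma rhead_continuous k : continuous (@rhead k).
Proof.
by move=> w; apply: continuous_comp; [exact: shead_continuous|exact: grange_continuous].
Qed.

(** The range of the first entry locally determines the string: a section of [grange] gives the
    first entry, whose source gives the tail by induction. Together with [slast_etale_on], it is the
    étale map cancelled from the other maps of strings. *)
Lemma rhead_etale_on k : etale_on (@composable1 G k) setT (@rhead k).
Proof.
elim: k => [|k ih]; first exact: grange_etale_on.
move=> p Cp; have [/= gw Cw] := Cp; split.
  by rewrite withinET; apply: cvg_within_filter; exact: rhead_continuous.
split=> //; rewrite withinET.
have [_ [_ [s [cs rs sr]]]] := @grange_etale_on G p.1 I.
have [_ [_ [t [ct rt tr]]]] := ih _ Cw.
have rw : rhead p.2 = gsource p.1 by rewrite gw.
rewrite !withinET in cs rs sr; rewrite withinET rw in ct rt.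
have cst : (gsource \o s) @ grange p.1 --> gsource p.1.
  by move=> P /gsource_cont /cs.
exists (fun y => (s y, t (gsource (s y)))); split.
- apply: cvg_to_within.
    apply: cvg_pair => //= P nP; exact: cst _ (cvg_from_within ct nP).
  have h1 : \forall y \near grange p.1, composable1 (t (gsource (s y))).
    exact: cst _ (ct _ (withinT _ _)).
  have h2 : \forall y \near grange p.1,
      rhead (t (gsource (s y))) = gsource (s y) by exact: cst _ rt.
  by apply: filterS2 h1 h2 => y h1 h2; split=> /=.
- exact: rs.
- have h1 : \forall z \near within (composable1 (k:=k.+1)) (nbhs p),
    s (grange z.1) = z.1 by exact: cvg_fst_composable _ sr.
  have h2 : \forall z \near within (composable1 (k:=k.+1)) (nbhs p),
    t (rhead z.2) = z.2 by exact: cvg_snd_composable _ tr.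
  have h3 : \forall z \near within (composable1 (k:=k.+1)) (nbhs p),
    composable1 (k:=k.+1) z by exact: withinT.
  apply: filterS3 h1 h2 h3 => -[g w] /= h1 h2 [/= h3 _].
  by rewrite /rhead /= h1 h3 -/(rhead w) h2.
Qed.

(** The mirror image: the tail is recovered from its last source, and the range of the tail then
    gives the first entry. *)
Lemma slast_etale_on k : etale_on (@composable1 G k) setT (@slast k).
Proof.
elim: k => [|k ih]; first exact: gsource_etale_on.
move=> p Cp; have [/= gw Cw] := Cp.
have [cl [_ [t [ct rt tr]]]] := ih _ Cw; split.
  by move=> P /cl /cvg_snd_composable.
split=> //; rewrite withinET.
have [_ [_ [s [cs rs sr]]]] := @gsource_etale_on G p.1 I.
have rw : gsource p.1 = rhead p.2 by rewrite gw.
rewrite !withinET in cs rs sr; rewrite withinET in ct rt; rewrite rw in cs rs.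
have crt : (@rhead k \o t) @ slast p.2 --> rhead p.2.
  by move=> P /(@rhead_continuous k) nP; exact: cvg_from_within ct _ nP.
exists (fun y => (s (rhead (t y)), t y)); split.
- apply: cvg_to_within.
    apply: cvg_pair => /=; first by move=> P /cs /crt.
    by move=> P nP; exact: cvg_from_within ct _ nP.
  have h1 : \forall y \near slast p.2, composable1 (t y).
    exact: ct _ (withinT _ _).
  have h2 : \forall y \near slast p.2,
      gsource (s (rhead (t y))) = rhead (t y) by exact: crt _ rs.
  by apply: filterS2 h1 h2 => y h1 h2; split=> /=.
- exact: rt.
- have h1 : \forall z \near within (composable1 (k:=k.+1)) (nbhs p),
    s (gsource z.1) = z.1 by exact: cvg_fst_composable _ sr.
  have h2 : \forall z \near within (composable1 (k:=k.+1)) (nbhs p),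
    t (slast z.2) = z.2 by exact: cvg_snd_composable _ tr.
  have h3 : \forall z \near within (composable1 (k:=k.+1)) (nbhs p),
    composable1 (k:=k.+1) z by exact: withinT.
  apply: filterS3 h1 h2 h3 => -[g w] /= h1 h2 [/= h3 _].
  by rewrite h2 /rhead -h3 h1.
Qed.

Lemma face1_first k (w : strings1 G k.+1) : face1 0 w = w.2.
Proof. by case: k w. Qed.

Lemma face1_composable k i (w : strings1 G k.+1) : composable1 w ->
  composable1 (face1 i w) /\ ((0 < i)%N -> rhead (face1 i w) = rhead w).
Proof.
elim: k i w => [|k ih] i [g w] /= [gw Cw].
  by split=> //; case: i => [|[|i]] // _; rewrite /rhead /= grange_mul.
case: i => [|[|i]] //.
  case: Cw => ww Cw; split; last by rewrite /rhead /= grange_mul.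
  by split=> //=; rewrite gsource_mul.
have [Cf rf] := ih i.+1 w Cw; split=> //; split=> //=.
by rewrite -/(rhead _) rf.
Qed.

Lemma face1_cvg k i (w : strings1 G k.+1) : composable1 w ->
  face1 i @ within (@composable1 G k.+1) (nbhs w) --> face1 i w.
Proof.
elim: k i w => [|k ih] i [g w] Cgw.
  have cg := @cvg_fst_composable 0 (g, w).
  have cw := cvg_from_within (@cvg_snd_composable 0 (g, w)).
  case: i => [|[|i]]; [exact: cw| |exact: cg].
  apply: cvg_gmul => //; first by case: Cgw.
  by apply: filterS (withinT _ _) => q [].
have [/= gw Cw] := Cgw.
have cg := @cvg_fst_composable k.+1 (g, w).
have cw := @cvg_snd_composable k.+1 (g, w).
case: i => [|[|i]]; first exact: cvg_from_within cw.
- apply: cvg_pair => /=.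
    apply: cvg_gmul => //; first by apply: filterS (withinT _ _) => q [].
    by move=> P /(@cvg_fst_composable _ w) /cw.
  by move=> P /(cvg_from_within (@cvg_snd_composable _ w)) /cw.
- by apply: cvg_pair => //= P /(ih i.+1 w Cw) /cw.
Qed.

(** On strings of length at least two, face [0] preserves the last source and every other face the
    first range, so [slast] or [rhead] can be cancelled. On single arrows the faces are [gsource]
    and [grange] themselves. *)
Lemma face_etale_on n i :
  etale_on (@composable G n.+1) (@composable G n) (@face G n i).
Proof.
case: n => [|k] /=.
  by case: i => [|i] /=; [exact: gsource_etale_on|exact: grange_etale_on].
have C1 (w : strings1 G k.+1) : composable1 w -> composable1 (face1 i w).
  by move=> Cw; have [] := face1_composable i Cw.
have cf : {within @composable1 G k.+1, continuous (@face1 G k i)}.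
  by apply/subspace_continuousP => w; exact: face1_cvg.
case: i C1 cf => [|i] C1 cf.
  apply: (etale_on_cancel C1 cf (@slast_etale_on k)).
  by apply: etale_on_eq (@slast_etale_on k.+1) => w _; rewrite /= face1_first.
apply: (etale_on_cancel C1 cf (@rhead_etale_on k)).
apply: etale_on_eq (@rhead_etale_on k.+1) => w Cw.
by have [_ /(_ isT)] := face1_composable i.+1 Cw => <-.
Qed.

End Strings.

Lemma continuous_pair (T U V : topologicalType) (f : T -> U) (g : T -> V) :
  continuous f -> continuous g -> continuous (fun x => (f x, g x)).
Proof. by move=> cf cg x; apply: cvg_pair; [exact: cf|exact: cg]. Qed.

(** * Maps of strings induced by homomorphisms and similarities *)

Section StringMap.
Variables (G H : etale_groupoid) (rho : gcar G -> gcar H).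

(** A homomorphism sends units to units; the range reads the image arrow as a point of the unit
    space. *)
Definition unit_map (x : gunit G) : gunit H := grange (rho (gid x)).

Fixpoint smap1 k : strings1 G k -> strings1 H k :=
  match k return strings1 G k -> strings1 H k with
  | 0 => rho
  | S _ => fun p => (rho p.1, smap1 p.2)
  end.

Definition smap n : strings G n -> strings H n :=
  match n return strings G n -> strings H n with
  | 0 => unit_map
  | S k => @smap1 k
  end.

Lemma shead_smap1 k (w : strings1 G k) : shead (smap1 w) = rho (shead w).
Proof. by case: k w. Qed.

Hypothesis hrho : hom_on [set: gcar G] rho.

Lemma gsource_hom g : gsource (rho g) = unit_map (gsource g).
Proof.
have e : gsource g = grange (gid (gsource g)) by rewrite grange_id.
by have [-> _] := hrho I I e.
Qed.

Lemma grange_hom g : grange (rho g) = unit_map (grange g).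
Proof.
have e : gsource (gid (grange g)) = grange g by rewrite gsource_id.
by have [<- _] := hrho I I e; rewrite gsource_hom gsource_id.
Qed.

Lemma smap1_composable k (w : strings1 G k) :
  composable1 w -> composable1 (smap1 w).
Proof.
elim: k w => [|k ih] //= [g w] /= [gw Cw]; split; last exact: ih.
by rewrite shead_smap1; have [] := @hrho g (shead w) I I gw.
Qed.

Lemma face1_smap1 k i (w : strings1 G k.+1) : composable1 w ->
  face1 i (smap1 w) = smap1 (face1 i w).
Proof.
elim: k i w => [|k ih] i [g w] /= [gw Cw].
  by case: i => [|[|i]] //; have [_ ->] := @hrho g w I I gw.
case: i => [|[|i]] //; last by rewrite ih.
by have [_ ->] := @hrho g w.1 I I gw.
Qed.

Lemma face_smap n i (w : strings G n.+1) : composable w ->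
  face i (smap w) = smap (face i w).
Proof.
case: n w => [|k] w Cw; last exact: face1_smap1.
by case: i => [|i] /=; [exact: gsource_hom|exact: grange_hom].
Qed.

Hypothesis erho : etale_on setT setT rho.

Lemma smap1_continuous k : continuous (@smap1 k).
Proof.
have crho : continuous rho by move=> g; have [+ _] := @erho g I; rewrite !withinET.
elim: k => [|k ih] //= p; apply: cvg_pair => /=.
  by move=> P /crho /fst_strings_continuous.
by move=> P /ih /snd_strings_continuous.
Qed.

Lemma unit_map_etale_on : etale_on setT setT unit_map.
Proof.
have e := etale_on_comp (@gid_etale_on G) erho.
by apply: etale_on_eq (etale_on_comp e (@grange_etale_on H)) => x _.
Qed.

(** Taking the range of the first entry intertwines [smap1] with [unit_map], which is étale as a
    composite; [rhead] is then cancelled. *)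
Lemma smap_etale_on n : etale_on (@composable G n) (@composable H n) (@smap n).
Proof.
case: n => [|k]; first exact: unit_map_etale_on.
apply: etale_on_cancel (@rhead_etale_on H k) _; first exact: smap1_composable.
  exact/continuous_subspaceT/smap1_continuous.
apply: etale_on_eq (etale_on_comp (@rhead_etale_on G k) unit_map_etale_on) => w _.
by rewrite /= /rhead shead_smap1 grange_hom.
Qed.

End StringMap.

Lemma smap_comp (G H L : etale_groupoid) (rho : gcar G -> gcar H)
    (sigma : gcar H -> gcar L) n (w : strings G n) :
  hom_on setT rho -> hom_on setT sigma ->
  smap sigma (smap rho w) = smap (sigma \o rho) w.
Proof.
move=> hr hs; case: n w => [x|k] /=.
  by rewrite /unit_map /= [RHS]grange_hom.
by elim: k => [|k ih] //= [g w] /=; rewrite ih.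
Qed.

(** * Prism maps of a similarity with the identity *)

Section HomotopyMap.
Variables (G : etale_groupoid) (tau : gcar G -> gcar G) (theta : gunit G -> gcar G).

Fixpoint hmap1 k : nat -> strings1 G k -> strings1 G k.+1 :=
  match k return nat -> strings1 G k -> strings1 G k.+1 with
  | 0 => fun j g => if j is 0 then (theta (grange g), tau g) else (g, theta (gsource g))
  | S k' => fun j p => if j is S j' then (p.1, hmap1 j' p.2)
                       else (theta (grange p.1), @smap1 G G tau k'.+1 p)
  end.

(* hmap j (g_1, ..., g_n) =
   (g_1, ..., g_j, theta (s g_j), tau g_(j+1), ..., tau g_n) *)
Definition hmap n : nat -> strings G n -> strings G n.+1 :=
  match n return nat -> strings G n -> strings G n.+1 with
  | 0 => fun _ => theta
  | S k => @hmap1 k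
  end.

Lemma hmap1_first k (w : strings1 G k) :
  hmap1 0 w = (theta (rhead w), smap1 tau w).
Proof. by case: k w. Qed.

Hypothesis htau : hom_on [set: gcar G] tau.
Hypothesis simtau : forall g : gcar G,
  [/\ gsource (theta (grange g)) = grange (tau g),
      gsource g = grange (theta (gsource g)) &
      gmul (theta (grange g)) (tau g) = gmul g (theta (gsource g))].

Lemma grange_theta x : grange (theta x) = x.
Proof. by have [_ + _] := simtau (gid x); rewrite gsource_id. Qed.

Lemma gsource_theta x : gsource (theta x) = unit_map tau x.
Proof. by have [+ _ _] := simtau (gid x); rewrite grange_id. Qed.

Lemma hmap1_composable k j (w : strings1 G k) : composable1 w ->
  composable1 (hmap1 j w) /\ rhead (hmap1 j w) = rhead w.
Proof.
elim: k j w => [|k ih] j w.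
  move=> _; have [h1 h2 _] := simtau w.
  by case: j => [|j] /=; split=> //; rewrite /rhead /= grange_theta.
move=> Cw; case: j => [|j].
  split; last by rewrite hmap1_first /rhead /= grange_theta.
  by split; [case: (simtau w.1)|exact: (@smap1_composable _ _ _ htau k.+1)].
case: w Cw => g w [/= gw Cw]; have [Ch rh] := ih j w Cw; split=> //.
by split=> //=; rewrite gw; exact: esym rh.
Qed.

Lemma face1_hmap1_first k (w : strings1 G k) : face1 0 (hmap1 0 w) = smap1 tau w.
Proof. by case: k w. Qed.

Lemma face1_hmap1_last k (w : strings1 G k) : face1 k.+2 (hmap1 k.+1 w) = w.
Proof. by elim: k w => [|k ih] //= [g w]; rewrite ih. Qed.

(** Both faces multiply across the inserted entry: one yields [g_(j+1) theta(s g_(j+1))], the other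
    [theta(r g_(j+1)) tau g_(j+1)], and the similarity equates them. *)
Lemma face1_hmap1_middle k j (w : strings1 G k) : composable1 w -> (j <= k)%N ->
  face1 j.+1 (hmap1 j.+1 w) = face1 j.+1 (hmap1 j w).
Proof.
elim: k j w => [|k ih] j w Cw.
  by rewrite leqn0 => /eqP -> /=; have [_ _ ->] := simtau w.
case: w Cw => g w [/= gw Cw]; case: j => [_|j jk] /=.
  have [_ _ ->] := simtau g; rewrite hmap1_first /= gw.
  by case: k w {ih gw Cw}.
by rewrite ih.
Qed.

(** The face touches only entries before the inserted one, which moves one place to the left. *)
Lemma face1_hmap1_below k i j (w : strings1 G k) : composable1 w ->
  (i <= j <= k)%N -> face1 i (hmap1 j.+1 w) = hmap j (face (n:=k) i w).
Proof.
elim: k i j w => [|k ih] i j w.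
  move=> _ /andP[ij]; rewrite leqn0 => /eqP j0.
  by move: ij; rewrite j0 leqn0 => /eqP ->.
case: w => g w [/= gw Cw] /andP[]; case: i => [|[|i]] ij jk.
- by case: k w j ij jk {ih gw Cw}.
- case: j ij jk => // j _; case: k w gw Cw {ih} => [|k] w gw Cw jk //=.
  by rewrite gsource_mul.
- case: j ij jk => // j ij jk; rewrite ih//; last by rewrite -ltnS ij.
  by case: k w gw Cw jk {ih} => [|k] w gw Cw jk //; case: j ij jk.
Qed.

(** The face touches only entries after the inserted one, already replaced by their images; merging
    two of them uses that [tau] is multiplicative. *)
Lemma face1_hmap1_above k i j (w : strings1 G k) : composable1 w ->
  (j < i <= k.+1)%N -> face1 i.+1 (hmap1 j w) = hmap j (face (n:=k) i w).
Proof.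
elim: k i j w => [|k ih] i j w.
  by move=> _ /andP[]; case: i => [|[|i]] //; case: j.
move=> Cw /andP[ji ik]; case: j ji => [|j] ji.
  case: i ji ik => // i _ _; rewrite [RHS]hmap1_first.
  have [_ -> //] := face1_composable i.+1 Cw.
  by rewrite -(face1_smap1 htau)//; case: (k) w {Cw ih}.
case: i ji ik => // i ji ik; case: w Cw => g w [/= gw Cw].
rewrite ih//; last by rewrite -ltnS ji.
case: k w gw Cw ik {ih} => [|k] w gw Cw ik.
  by case: i ji ik => [|[|i]] //; case: j => //= _ _; rewrite gw.
by case: i ji ik.
Qed.

Hypotheses (etau : etale_on setT setT tau) (ctheta : continuous theta).

Lemma hmap1_continuous k j : continuous (@hmap1 k j).
Proof.
have ctau : continuous tau by move=> g; have [+ _] := @etau g I; rewrite !withinET.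
elim: k j => [|k ih] [|j].
- apply: continuous_pair => // g P.
  by move=> /ctheta /(@grange_continuous G).
- apply: continuous_pair => g P //.
  by move=> /ctheta /(@gsource_cont G).
- apply: continuous_pair; last exact: (@smap1_continuous _ _ _ etau k.+1).
  by move=> p P /ctheta /(@grange_continuous G) /fst_strings_continuous.
- apply: continuous_pair; first exact: fst_strings_continuous.
  by move=> p P /ih /snd_strings_continuous.
Qed.

(** In positive degree the prism maps preserve the range of the first entry, so [rhead] cancels; in
    degree [0] the map is [theta], a section of [grange]. *)
Lemma hmap_etale_on n j : etale_on (@composable G n) (@composable G n.+1) (@hmap n j).
Proof.
case: n => [|k]; first exact: (grange_section_etale_on ctheta grange_theta).
apply: etale_on_cancel (@rhead_etale_on G k.+1) _.
- by move=> w Cw; have [] := hmap1_composable j Cw.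
- exact/continuous_subspaceT/hmap1_continuous.
apply: etale_on_eq (@rhead_etale_on G k) => w Cw.
by have [_] := hmap1_composable j Cw.
Qed.

End HomotopyMap.

(** * The chain homotopy *)

(* The prism identity: [a i j] and [b i j] stand for the terms [d_i h_j] and
   [h_j d_i] of the double sums. *)
Lemma prism_sum (M : zmodType) (n : nat) (a b : nat -> nat -> M) :
  (forall j, (j < n)%N -> a j.+1 j.+1 = a j.+1 j) ->
  (forall i j, (i <= j < n)%N -> a i j.+1 = b i j) ->
  (forall i j, (j < i <= n)%N -> a i.+1 j = b i j) ->
  \sum_(i < n.+2) (\sum_(j < n.+1) a i j *~ (-1) ^+ j) *~ (-1) ^+ i
  + \sum_(j < n) (\sum_(i < n.+1) b i j *~ (-1) ^+ i) *~ (-1) ^+ j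
  = a 0%N 0%N - a n.+1 n.
Proof.
move=> adiag abelow aabove.
pose A i j := a i j *~ (-1) ^+ (i + j); pose B i j := b i j *~ (-1) ^+ (i + j).
have -> : \sum_(i < n.+2) (\sum_(j < n.+1) a i j *~ (-1) ^+ j) *~ (-1) ^+ i
    = \sum_(0 <= j < n.+1) \sum_(0 <= i < n.+2) A i j.
  rewrite big_mkord; under [RHS]eq_bigr do rewrite big_mkord.
  rewrite exchange_big; apply: eq_bigr => i _ /=.
  by rewrite mulrz_suml; apply: eq_bigr => j _; rewrite -mulrzA -exprD addnC.
have -> : \sum_(j < n) (\sum_(i < n.+1) b i j *~ (-1) ^+ i) *~ (-1) ^+ j
    = \sum_(0 <= j < n) \sum_(0 <= i < n.+1) B i j.
  rewrite big_mkord; apply: eq_bigr => j _; rewrite big_mkord.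
  by rewrite mulrz_suml; apply: eq_bigr => i _; rewrite -mulrzA -exprD.
(* For fixed [j] the terms [i = j] and [i = j + 1] carry opposite signs and form the diagonal part;
   the rest splits into [i < j] and [i > j + 1]. *)
have splitA j : (j < n.+1)%N -> \sum_(0 <= i < n.+2) A i j =
    \sum_(0 <= i < j) A i j + (a j j - a j.+1 j) + \sum_(j.+1 <= i < n.+1) A i.+1 j.
  move=> jn; rewrite (@big_cat_nat _ _ _ j)//=; last by rewrite ltnW// ltnW.
  rewrite -addrA; congr (_ + _).
  rewrite big_ltn; last by rewrite ltnW.
  rewrite big_ltn// addrA big_add1 /=; congr (_ + _ + _).
    by rewrite /A addnn -signr_odd odd_double expr0 mulr1z.
  by rewrite /A addSn addnn -signr_odd /= odd_double expr1 mulrN1z.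
rewrite (eq_big_nat _ _ (F2 := fun j => \sum_(0 <= i < j) A i j +
  (a j j - a j.+1 j) + \sum_(j.+1 <= i < n.+1) A i.+1 j)); last first.
  by move=> j /andP[_ jn]; exact: splitA.
rewrite big_split /= [X in X + _ + _]big_split /=.
(* The index [j = 0] contributes nothing; shifting [j] by one turns [a] into [b] and reverses the
   sign. *)
have -> : \sum_(0 <= j < n.+1) \sum_(0 <= i < j) A i j =
    - \sum_(0 <= j < n) \sum_(0 <= i < j.+1) B i j.
  rewrite big_nat_recl// [X in X + _]big_geq// add0r -sumrN; apply: eq_big_nat => j /andP[_ jn].
  rewrite -sumrN; apply: eq_big_nat => i /andP[_ ij].
  have ijn : (i <= j < n)%N by rewrite -ltnS ij jn.
  by rewrite /A /B (abelow _ _ ijn) addnS exprS mulN1r mulrNz.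
(* Here [j = n] contributes nothing, and the shift that reverses the sign is in [i]. *)
have -> : \sum_(0 <= j < n.+1) \sum_(j.+1 <= i < n.+1) A i.+1 j =
    - \sum_(0 <= j < n) \sum_(j.+1 <= i < n.+1) B i j.
  rewrite big_nat_recr//= (@big_geq _ _ _ n.+1 n.+1)// addr0 -sumrN.
  apply: eq_big_nat => j /andP[_ jn].
  rewrite -sumrN; apply: eq_big_nat => i /andP[ji ii].
  have jin : (j < i <= n)%N by rewrite ji -ltnS ii.
  by rewrite /A /B (aabove _ _ jin) addSn exprS mulN1r mulrNz.
have -> : \sum_(0 <= j < n) \sum_(0 <= i < n.+1) B i j =
    \sum_(0 <= j < n) \sum_(0 <= i < j.+1) B i j +
    \sum_(0 <= j < n) \sum_(j.+1 <= i < n.+1) B i j.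
  rewrite -big_split /=; apply: eq_big_nat => j /andP[_ jn].
  by rewrite -big_cat_nat//= ltnS ltnW.
(* The diagonal part telescopes by [adiag]; the induction runs over [m <= n], the range in which
   [adiag] applies. *)
have -> : \sum_(0 <= j < n.+1) (a j j - a j.+1 j) = a 0%N 0%N - a n.+1 n.
  have : (n <= n)%N by []; elim: {-2}n => [_|m ih mn]; first by rewrite big_nat1.
  by rewrite big_nat_recr//= ih 1?ltnW// adiag// addrA subrK.
move: (a 0%N 0%N - a n.+1 n) (\sum_(0 <= j < n) \sum_(0 <= i < j.+1) B i j)
  (\sum_(0 <= j < n) \sum_(j.+1 <= i < n.+1) B i j) => X Y Z.
by rewrite [- Y + X]addrC -[X - Y - Z]addrA -opprD subrK.
Qed.

Lemma fct_mulrz (T : Type) (M : zmodType) (f : T -> M) (m : int) (x : T) :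
  (f *~ m) x = f x *~ m.
Proof.
have natE k : (f *+ k) x = f x *+ k.
  by elim: k => [|k ih]; rewrite ?mulr0n// !mulrS -ih.
by case: m => k; rewrite ?NegzE ?mulrNz /intmul /= -?natE.
Qed.

(** * The boundary operator and induced chain maps *)

Section Chains.
Variables (G : etale_groupoid) (A : topologicalZmodType).
Local Notation C n := (@composable G n).

(** Puts the pointwise formula into the group of functions, where additivity of fiber sums applies
    face by face. *)
Lemma boundaryE n (f : strings G n.+1 -> A) :
  boundary f = \sum_(i < n.+2) fiber_sum (C n.+1) (@face G n i) f *~ (-1) ^+ i.
Proof.
apply/funext => y; rewrite fct_sumE /boundary; apply: eq_bigr => i _.
by rewrite fct_mulrz.
Qed.

Lemma face_sum_cc n i (f : strings G n.+1 -> A) : chain f ->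
  cc (C n) (fiber_sum (C n.+1) (@face G n i) f).
Proof.
move=> cf; apply: fiber_sum_cc cf.
- exact: strings_hausdorff.
- exact: strings_hausdorff.
- exact: composable_closed.
- exact: face_etale_on.
Qed.

Lemma boundary0 n : boundary (0 : strings G n.+1 -> A) = 0.
Proof.
by rewrite boundaryE big1// => i _; rewrite fiber_sum0 mul0rz.
Qed.

Lemma boundaryD n (f g : strings G n.+1 -> A) : chain f -> chain g ->
  boundary (f + g) = boundary f + boundary g.
Proof.
move=> cf cg; rewrite !boundaryE -big_split; apply: eq_bigr => i _ /=.
rewrite (fiber_sumD (@strings_hausdorff G n) (@composable_closed G n.+1)
  (@face_etale_on G n i))//.
by rewrite mulrzDl.
Qed.

Lemma boundaryN n (f : strings G n.+1 -> A) : boundary (- f) = - boundary f.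
Proof.
rewrite !boundaryE -sumrN; apply: eq_bigr => i _ /=.
by rewrite fiber_sumN mulNrz.
Qed.

Lemma boundariesB n (f g : strings G n -> A) :
  boundaries f -> boundaries g -> boundaries (f - g).
Proof.
move=> [u cu <-] [v cv <-]; exists (u - v); first exact: ccB.
by rewrite boundaryD ?boundaryN//; exact: ccN.
Qed.

Lemma boundaries0 n : boundaries (0 : strings G n -> A).
Proof. by exists 0; [exact: cc0|exact: boundary0]. Qed.

Lemma cycles_chain n (f : strings G n -> A) : cycles f -> chain f.
Proof. by case: n f => [|n] f //= []. Qed.

End Chains.

Section InducedMap.
Variables (G H : etale_groupoid) (A : topologicalZmodType).
Variable rho : gcar G -> gcar H.
Hypotheses (hrho : hom_on setT rho) (erho : etale_on setT setT rho).

Definition induced n (f : strings G n -> A) : strings H n -> A :=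
  fiber_sum (@composable G n) (@smap G H rho n) f.

Lemma induced_chain n (f : strings G n -> A) : chain f -> chain (induced f).
Proof.
move=> cf; apply: fiber_sum_cc cf.
- exact: strings_hausdorff.
- exact: strings_hausdorff.
- exact: composable_closed.
- exact: smap_etale_on.
Qed.

Lemma inducedD n (f g : strings G n -> A) : chain f -> chain g ->
  induced (f + g) = induced f + induced g.
Proof.
exact: (fiber_sumD (@strings_hausdorff H n) (@composable_closed G n)
  (smap_etale_on hrho erho (n:=n))).
Qed.

Lemma induced0 n : induced (0 : strings G n -> A) = 0.
Proof. exact: fiber_sum0. Qed.

(** Fiber sums compose, and faces commute with [smap] on composable strings, so the two sides agree
    face by face. *)
Lemma boundary_induced n (f : strings G n.+1 -> A) : chain f ->
  boundary (induced f) = induced (boundary f).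
Proof.
move=> cf; rewrite !boundaryE /induced (fiber_sum_sum (@strings_hausdorff H n)
  (@composable_closed G n) (smap_etale_on hrho erho (n:=n))); last first.
  by move=> i; apply: cc_signed; exact: face_sum_cc.
apply: eq_bigr => i _; rewrite fiber_sum_signed; congr (_ *~ _).
rewrite (fiber_sum_comp (@strings_hausdorff H n) (@composable_closed G n.+1)
  (smap_etale_on hrho erho (n:=n.+1)) (@face_etale_on H n i) cf).
rewrite (fiber_sum_comp (@strings_hausdorff H n) (@composable_closed G n.+1)
  (@face_etale_on G n i) (smap_etale_on hrho erho (n:=n)) cf).
by apply: fiber_sum_eq => w Cw; exact: face_smap.
Qed.

Lemma induced_cycles n (f : strings G n -> A) : cycles f -> cycles (induced f).
Proof.
case: n f => [|n] f; first exact: induced_chain.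
move=> [cf df]; split; first exact: induced_chain.
by rewrite boundary_induced// df induced0.
Qed.

Lemma induced_boundaries n (f : strings G n -> A) :
  boundaries f -> boundaries (induced f).
Proof.
move=> [g cg <-]; exists (induced g); first exact: induced_chain.
exact: boundary_induced.
Qed.

End InducedMap.

Lemma induced_comp (G H L : etale_groupoid) (A : topologicalZmodType)
    (rho : gcar G -> gcar H) (sigma : gcar H -> gcar L) n (f : strings G n -> A) :
  hom_on setT rho -> etale_on setT setT rho ->
  hom_on setT sigma -> etale_on setT setT sigma -> chain f ->
  induced sigma (induced rho f) = induced (sigma \o rho) f.
Proof.
move=> hr er hs es cf; rewrite /induced.
rewrite (fiber_sum_comp (@strings_hausdorff L n) (@composable_closed G n)
  (smap_etale_on hr er (n:=n)) (smap_etale_on hs es (n:=n)) cf).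
by apply: fiber_sum_eq => w _; exact: smap_comp.
Qed.

(** * The homotopy between an induced map and the identity *)

Section Homotopy.
Variables (G : etale_groupoid) (A : topologicalZmodType).
Variables (tau : gcar G -> gcar G) (theta : gunit G -> gcar G).
Hypotheses (htau : hom_on setT tau) (etau : etale_on setT setT tau).
Hypothesis ctheta : continuous theta.
Hypothesis simtau : forall g : gcar G,
  [/\ gsource (theta (grange g)) = grange (tau g),
      gsource g = grange (theta (gsource g)) &
      gmul (theta (grange g)) (tau g) = gmul g (theta (gsource g))].

Let ehmap n j := hmap_etale_on htau simtau etau ctheta (n:=n) j.

Definition homotopy n (f : strings G n -> A) : strings G n.+1 -> A :=
  \sum_(j < n.+1) fiber_sum (@composable G n) (hmap tau theta j) f *~ (-1) ^+ j.

Lemma hmap_sum_cc n j (f : strings G n -> A) : chain f ->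
  cc (@composable G n.+1) (fiber_sum (@composable G n) (hmap tau theta j) f).
Proof.
move=> cf; apply: fiber_sum_cc cf.
- exact: strings_hausdorff.
- exact: strings_hausdorff.
- exact: composable_closed.
- exact: ehmap.
Qed.

Lemma homotopy_chain n (f : strings G n -> A) : chain f -> chain (homotopy f).
Proof. by move=> cf; apply: cc_sum => j _; apply: cc_signed; exact: hmap_sum_cc. Qed.

Lemma boundary_homotopy n (f : strings G n -> A) : chain f ->
  boundary (homotopy f) = \sum_(i < n.+2) (\sum_(j < n.+1)
    fiber_sum (@composable G n) (@face G n i \o hmap tau theta j) f
      *~ (-1) ^+ j) *~ (-1) ^+ i.
Proof.
move=> cf; rewrite boundaryE; apply: eq_bigr => i _; congr (_ *~ _).
rewrite (fiber_sum_sum (@strings_hausdorff G n) (@composable_closed G n.+1)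
  (@face_etale_on G n i)); last first.
  by move=> j; apply: cc_signed; exact: hmap_sum_cc.
apply: eq_bigr => j _; rewrite fiber_sum_signed; congr (_ *~ _).
exact: (fiber_sum_comp (@strings_hausdorff G n) (@composable_closed G n)
  (@ehmap n j) (@face_etale_on G n i) cf).
Qed.

Lemma homotopy_boundary n (f : strings G n.+1 -> A) : chain f ->
  homotopy (boundary f) = \sum_(j < n.+1) (\sum_(i < n.+2)
    fiber_sum (@composable G n.+1) (hmap tau theta j \o @face G n i) f
      *~ (-1) ^+ i) *~ (-1) ^+ j.
Proof.
move=> cf; rewrite /homotopy; apply: eq_bigr => j _; congr (_ *~ _).
rewrite boundaryE (fiber_sum_sum (@strings_hausdorff G n.+1)
  (@composable_closed G n) (@ehmap n j)); last first.
  by move=> i; apply: cc_signed; exact: face_sum_cc.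
apply: eq_bigr => i _; rewrite fiber_sum_signed; congr (_ *~ _).
exact: (fiber_sum_comp (@strings_hausdorff G n.+1) (@composable_closed G n.+1)
  (@face_etale_on G n i) (@ehmap n j) cf).
Qed.

(** The chain [homotopy f] bounds the difference: in positive degree the other term of the homotopy
    formula, [homotopy (boundary f)], vanishes on cycles. *)
Lemma similar_id_homotopic n (f : strings G n -> A) : cycles f ->
  boundaries (induced tau f - f).
Proof.
move=> zf; have cf := cycles_chain zf.
exists (homotopy f); first exact: homotopy_chain.
have f0 w : ~ composable w -> f w = 0 by case: cf => _ + _; exact.
rewrite boundary_homotopy//; case: n f zf cf f0 => [|n] f zf cf f0.
  (* In degree [0] the two faces of [theta] are its source, which is [unit_map tau], and its range,
     which is the identity. *)
  rewrite 2!big_ord_recl big_ord0 !big_ord1 /= !mulr1z addr0 mulrN1z.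
  rewrite /induced -[X in _ = _ - X](fiber_sum_id f0); congr (_ - _); apply: fiber_sum_eq => x _ /=.
    exact: (gsource_theta simtau).
  exact: (grange_theta simtau).
have hb := homotopy_boundary cf; have [_ df] := zf.
have h0 : homotopy (0 : strings G n -> A) = 0.
  by rewrite /homotopy big1// => j _; rewrite fiber_sum0 mul0rz.
(* The vanishing [homotopy (boundary f)] is added in expanded form to give the left side of the
   prism identity; the two surviving extreme terms are [smap tau] and the identity. *)
rewrite df h0 in hb; rewrite -[LHS]addr0 [X in _ + X]hb.
rewrite (@prism_sum _ n.+1
  (fun i j => fiber_sum (@composable G n.+1) (@face G n.+1 i \o hmap tau theta j) f)
  (fun i j => fiber_sum (@composable G n.+1) (hmap tau theta j \o @face G n i) f)).
- rewrite /induced -[X in _ = _ - X](fiber_sum_id f0); congr (_ - _); apply: fiber_sum_eq => w _ /=.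
    exact: face1_hmap1_first.
  exact: face1_hmap1_last.
- by move=> j jn; apply: fiber_sum_eq => w Cw; exact: (face1_hmap1_middle simtau).
- by move=> i j ijn; apply: fiber_sum_eq => w Cw; exact: face1_hmap1_below.
- by move=> i j ijn; apply: fiber_sum_eq => w Cw; apply: face1_hmap1_above.
Qed.

End Homotopy.

(** * Homological similarity and homology *)

Lemma hom_on_comp (G H L : etale_groupoid) (D : set (gcar G)) (E : set (gcar H))
    (f : gcar G -> gcar H) (f' : gcar H -> gcar L) :
  (forall g, D g -> E (f g)) ->
  hom_on D f -> hom_on E f' -> hom_on D (f' \o f).
Proof.
move=> DE hf hf' g h Dg Dh gh; have [fgh fM] := hf g h Dg Dh gh.
have [fgh' fM'] := hf' _ _ (DE _ Dg) (DE _ Dh) fgh.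
by rewrite /= fM fM'.
Qed.

Section SimilarHomology.
Variables (G H : etale_groupoid).
Variables (rho : gcar G -> gcar H) (sigma : gcar H -> gcar G).
Hypotheses (rhoP : etale_homomorphism rho) (sigmaP : etale_homomorphism sigma).
Hypotheses (simG : Defs.similar (sigma \o rho) id) (simH : Defs.similar (rho \o sigma) id).
Variable A : topologicalZmodType.

Let hrho : hom_on setT rho. Proof. by have [[]] := rhoP. Qed.
Let erho : etale_on setT setT rho.
Proof. by apply/local_homeo_etale; have [] := rhoP. Qed.
Let hsigma : hom_on setT sigma. Proof. by have [[]] := sigmaP. Qed.
Let esigma : etale_on setT setT sigma.
Proof. by apply/local_homeo_etale; have [] := sigmaP. Qed.

Lemma induced_left_inverse n (f : strings G n -> A) : cycles f ->
  boundaries (induced sigma (induced rho f) - f).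
Proof.
move=> zf; rewrite induced_comp//; last exact: cycles_chain.
have [theta [ctheta thetaP]] := simG.
apply: (similar_id_homotopic _ _ ctheta thetaP zf).
- exact: hom_on_comp hrho hsigma.
- exact: etale_on_comp erho esigma.
Qed.

Lemma induced_right_inverse n (f : strings H n -> A) : cycles f ->
  boundaries (induced rho (induced sigma f) - f).
Proof.
move=> zf; rewrite induced_comp//; last exact: cycles_chain.
have [theta [ctheta thetaP]] := simH.
apply: (similar_id_homotopic _ _ ctheta thetaP zf).
- exact: hom_on_comp hsigma hrho.
- exact: etale_on_comp esigma erho.
Qed.

(** The kernel is found by applying [induced sigma] and correcting by [induced_left_inverse];
    surjectivity is [induced_right_inverse]. *)
Lemma induced_quot_iso n :
  quot_iso (@cycles G A n) (@boundaries G A n)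
           (@cycles H A n) (@boundaries H A n) (@induced G H A rho n).
Proof.
split.
- by move=> z; exact: induced_cycles.
- move=> z z' /cycles_chain cz /cycles_chain cz'.
  by rewrite inducedD// addrAC addrK subrr; exact: boundaries0.
- move=> z zz; split; last exact: induced_boundaries.
  move=> /(induced_boundaries hsigma esigma) bz.
  have := boundariesB bz (induced_left_inverse zz).
  by rewrite opprB addrCA subrr addr0.
- move=> w zw; exists (induced sigma w); first exact: induced_cycles.
  exact: induced_right_inverse.
Qed.

End SimilarHomology.

Lemma homologically_similar_homology_iso (G H : etale_groupoid)
    (A : topologicalZmodType) n :
  homologically_similar G H -> homology_iso G H A n.
Proof.
move=> [rho [sigma [er es sG sH]]]; exists (@induced G H A rho n).
exact: (induced_quot_iso er es sG sH).
Qed.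

Lemma induced_nonneg (G H : etale_groupoid) (rho : gcar G -> gcar H) n
    (f : strings G n -> Zdisc) : nonneg_fun f -> nonneg_fun (induced rho f).
Proof.
move=> f0 y; rewrite /induced /fiber_sum.
apply: (big_ind (fun z : Zdisc => (0 <= (z : int))%R)) => //.
by move=> a b; exact: (@addr_ge0 int).
Qed.

(** Fiber sums of nonnegative functions are nonnegative, so [induced rho] carries positive classes
    forward and [induced sigma] supplies positive preimages. *)
Lemma homologically_similar_H0_order_iso (G H : etale_groupoid) :
  homologically_similar G H -> H0_order_iso G H.
Proof.
move=> [rho [sigma [er es sG sH]]].
have [[_ hr] /local_homeo_etale lr] := er; have [[_ hs] /local_homeo_etale ls] := es.
exists (@induced G H Zdisc rho 0); split.
- exact: (induced_quot_iso er es sG sH).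
- move=> z zz z0; exists (induced (n:=0) rho z).
    by split; [exact: (induced_cycles hr lr (n:=0) zz)|exact: induced_nonneg].
  by rewrite subrr; exact: (@boundaries0 H Zdisc 0).
- move=> w zw w0; exists (induced (n:=0) sigma w).
    by split; [exact: (induced_cycles hs ls (n:=0) zw)|exact: induced_nonneg].
  exact: (induced_right_inverse er es sH (n:=0) zw).
Qed.

(** * Kakutani equivalence implies homological similarity *)

Lemma clopen_piecewise_cvg (T U : topologicalType) (B : set T) (f g : T -> U) x :
  clopen B -> (B x -> f @ x --> f x) -> (~ B x -> g @ x --> g x) ->
  (fun y => if y \in B then f y else g y) @ x --> (if x \in B then f x else g x).
Proof.
move=> [oB cB] cf cg; case: ifPn => [/set_mem Bx|/negP nBx] P nP.
  have nB : \forall y \near x, B y by exact: open_nbhs_nbhs.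
  by apply: filterS2 nB (cf Bx P nP) => y By /=; rewrite mem_set.
have {}nBx : (~` B) x by move=> Bx; apply: nBx; rewrite inE.
have nB : \forall y \near x, (~` B) y.
  by apply: open_nbhs_nbhs; split => //; exact: closed_openC.
by apply: filterS2 nB (cg nBx P nP) => y nBy /=; rewrite memNset.
Qed.

(* A unit space with a clopen base is covered by finitely many clopen sets
   carrying local sections of the range map with source in Y; these are glued
   along a disjointification. *)
Lemma full_section (G : etale_groupoid) (Y : set (gunit G)) :
  compact [set: gunit G] -> totally_disconnected [set: gunit G] ->
  clopen Y -> gfull Y ->
  exists theta : gunit G -> gcar G,
  [/\ continuous theta, (forall x, grange (theta x) = x),
      (forall x, Y (gsource (theta x))) & (forall x, Y x -> theta x = gid x)].
Proof.
move=> cX tX cY fY.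
have zX := totally_disconnected_zero_dimensional (@gunit_hausdorff G) cX tX.
have [B [t [cB BT tB]]] : exists (B : set (gunit G)) (t : gunit G -> gcar G),
    [/\ clopen B, setT `<=` B & forall x, B x ->
       [/\ t @ x --> t x, grange (t x) = x & Y (gsource (t x))]].
  apply: (compact_induction (P := fun S : set (gunit G) =>
      exists (B : set (gunit G)) (t : gunit G -> gcar G),
      [/\ clopen B, S `<=` B & forall x, B x ->
       [/\ t @ x --> t x, grange (t x) = x & Y (gsource (t x))]]) cX).
  - by exists set0, gid; split=> //; exact: clopen0.
  - move=> S S' SS' [B [t [cB SB tB]]]; exists B, t; split=> //.
    exact: subset_trans SB.
  - move=> S S' [B [t [cB SB tB]]] [B' [t' [cB' SB' tB']]].
    exists (B `|` B'), (fun y => if y \in B then t y else t' y); split.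
    + exact: clopenU.
    + exact: setUSS.
    + move=> x BBx; split.
      * apply: clopen_piecewise_cvg => // [/tB[]//|nBx].
        by case: BBx => // /tB'[].
      * case: ifPn => [/set_mem/tB[]//|/negP nBx].
        case: BBx => [Bx|/tB'[]//]; first by case: nBx; rewrite inE.
      * case: ifPn => [/set_mem/tB[]//|/negP nBx].
        case: BBx => [Bx|/tB'[]//]; first by case: nBx; rewrite inE.
  - move=> x _; have [g [gx Yg]] := fY x.
    have [W [s [oW Wx sW sg]]] := local_homeo_section (grange_etale G) g.
    have sx : s x = g by rewrite -gx (nbhs_singleton sg).
    (* As [Y] is open, the section through [g] keeps its source in [Y] near [x]; zero-dimensionality
       then gives a clopen neighbourhood inside this region. *)
    have nU : \forall y \near x, W y /\ Y (gsource (s y)).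
      have h1 : \forall y \near x, W y by apply: open_nbhs_nbhs; rewrite -gx.
      have h2 : \forall y \near x, Y (gsource (s y)).
        rewrite gx in Wx; have [cs _] := sW x Wx; rewrite sx in cs.
        apply: (cs (gsource @^-1` Y)); apply: gsource_cont.
        by apply: open_nbhs_nbhs; split=> //; case: cY.
      by apply: filterS2 h1 h2.
    have [D [Dx cD] DU] := zero_dimensional_cvg (@gunit_hausdorff G) zX cX nU.
    exists D; first by apply: open_nbhs_nbhs; split=> //; case: cD.
    exists D, s; split=> // y /DU[Wy Ysy].
    by have [csy rsy] := sW y Wy.
(* Units replace the section over the clopen set [Y], so that conjugation will fix the reduction to
   [Y]. *)
exists (fun x => if x \in Y then gid x else t x); split.
- move=> x; apply: clopen_piecewise_cvg => // _; first exact: gid_cont.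
  by have [] := tB x (BT x I).
- by move=> x; case: ifPn => _; [rewrite grange_id|have [] := tB x (BT x I)].
- move=> x; case: ifPn => [/set_mem Yx|_]; first by rewrite gsource_id.
  by have [] := tB x (BT x I).
- by move=> x Yx; rewrite mem_set.
Qed.

Lemma open_reduction (G : etale_groupoid) (Y : set (gunit G)) :
  open Y -> open (reduction Y).
Proof.
move=> oY; apply: openI; first by apply: open_comp => // g _; exact: grange_continuous.
by apply: open_comp => // g _; exact: gsource_cont.
Qed.

(** * Retraction of a groupoid onto a reduction *)

Section Retraction.
Variables (G : etale_groupoid) (Y : set (gunit G)) (theta : gunit G -> gcar G).
Hypotheses (oY : open Y) (ctheta : continuous theta).
Hypotheses (rtheta : forall x, grange (theta x) = x).
Hypotheses (stheta : forall x, Y (gsource (theta x))).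
Implicit Types g h : gcar G.

Definition retract g : gcar G :=
  gmul (ginv (theta (grange g))) (gmul g (theta (gsource g))).

Let gt g : gsource g = grange (theta (gsource g)). Proof. by rewrite rtheta. Qed.

Let tgt g : gsource (ginv (theta (grange g))) = grange (gmul g (theta (gsource g))).
Proof. by rewrite gsource_inv rtheta grange_mul. Qed.

Lemma grange_retract g : grange (retract g) = gsource (theta (grange g)).
Proof. by rewrite grange_mul// grange_inv. Qed.

Lemma gsource_retract g : gsource (retract g) = gsource (theta (gsource g)).
Proof. by rewrite gsource_mul// gsource_mul. Qed.

Lemma retract_reduction g : reduction Y (retract g).
Proof. by split; rewrite ?grange_retract ?gsource_retract. Qed.

Lemma theta_retract g : gmul (theta (grange g)) (retract g) = gmul g (theta (gsource g)).
Proof.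
rewrite -gmulA ?grange_inv//.
by rewrite gmulV rtheta -[RHS]gid_mul grange_mul.
Qed.

(** Left multiplication by [theta (grange g)] is injective where defined, and by [theta_retract] it
    turns both sides of the product formula into [g h theta(s h)]. *)
Lemma retract_hom : hom_on setT retract.
Proof.
move=> g h _ _ gh.
have rgh : gsource (retract g) = grange (retract h).
  by rewrite gsource_retract grange_retract gh.
split=> //; apply: (@gmul_inj_r _ (theta (grange g))).
- by rewrite grange_retract grange_mul.
- by rewrite grange_mul// grange_retract.
have := theta_retract (gmul g h); rewrite grange_mul// gsource_mul// => ->.
rewrite gmulA// -theta_retract -gh -gmulA//; last first.
  by rewrite grange_retract -gh.
rewrite -theta_retract gmulA//.
by rewrite grange_retract.
Qed.

Lemma retract_continuous : continuous retract.
Proof.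
move=> g; apply: cvg_gmul => //.
- exact: nearW.
- by move=> P /(@ginv_cont G) /ctheta /(@grange_continuous G).
- apply: cvg_gmul => //; first exact: nearW.
  by move=> P /ctheta /(@gsource_cont G).
Qed.

(** The range of [retract g] is [gsource (theta (grange g))], an étale function of [g] since [theta]
    is a continuous section; [grange] is then cancelled. *)
Lemma retract_etale_on : etale_on setT (reduction Y) retract.
Proof.
apply: etale_on_restrictr (open_reduction oY) _ _ => [g _|].
  exact: retract_reduction.
apply: etale_on_cancel (@grange_etale_on G) _ => //.
  exact/continuous_subspaceT/retract_continuous.
have e := etale_on_comp (etale_on_comp (@grange_etale_on G)
  (grange_section_etale_on ctheta rtheta)) (@gsource_etale_on G).
by apply: etale_on_eq e => g _; rewrite /= grange_retract.
Qed.

Lemma retract_similar : Defs.similar retract id.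
Proof.
exists theta; split=> // g; split; first by rewrite grange_retract.
  exact: gt.
exact: theta_retract.
Qed.

Lemma retract_on_reduction g : (forall x, Y x -> theta x = gid x) ->
  reduction Y g -> retract g = g.
Proof.
move=> tY [Yr Ys]; apply: (@gmul_inj_r _ (theta (grange g))).
- by rewrite grange_retract.
- by rewrite tY// gsource_id.
by rewrite theta_retract !tY// gmul_id gid_mul.
Qed.

End Retraction.

Lemma kakutani_homologically_similar (G1 G2 : etale_groupoid) :
  compact [set: gunit G1] -> totally_disconnected [set: gunit G1] ->
  compact [set: gunit G2] -> totally_disconnected [set: gunit G2] ->
  kakutani_equivalent G1 G2 -> homologically_similar G1 G2.
Proof.
move=> c1 t1 c2 t2 [Y1 [Y2 [cY1 fY1 cY2 fY2]]].
move=> [phi [psi [[p1 p2 pp1 pp2] [cphi cpsi hphi hpsi]]]].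
have [oY1 _] := cY1; have [oY2 _] := cY2.
have [th1 [ct1 rt1 st1 tY1]] := full_section c1 t1 cY1 fY1.
have [th2 [ct2 rt2 st2 tY2]] := full_section c2 t2 cY2 fY2.
have red1 g : reduction Y1 (retract th1 g) by exact: retract_reduction.
have red2 g : reduction Y2 (retract th2 g) by exact: retract_reduction.
(* An isomorphism of reductions is étale between them, and the target reduction is open in [G2]. *)
have ephi : etale_on (reduction Y1) setT phi.
  apply: etale_on_openr (open_reduction oY2) _.
  exact: inverse_etale_on p1 p2 pp1 pp2 cphi cpsi.
have epsi : etale_on (reduction Y2) setT psi.
  apply: etale_on_openr (open_reduction oY1) _.
  exact: inverse_etale_on p2 p1 pp2 pp1 cpsi cphi.
have ehom (G H : etale_groupoid) (f : gcar G -> gcar H) :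
    hom_on setT f -> etale_on setT setT f -> etale_homomorphism f.
  by move=> hf /local_homeo_etale lf; split=> //; split=> //; case: lf.
(* [phi] maps the image of [retract th1] into the reduction to [Y2], which [retract th2] fixes;
   [psi] then undoes [phi], so the composite is exactly [retract th1]. *)
have sr : psi \o retract th2 \o (phi \o retract th1) = retract th1.
  apply/funext => g /=; rewrite (retract_on_reduction rt2 tY2) ?pp1//.
  exact: p1.
have rs : phi \o retract th1 \o (psi \o retract th2) = retract th2.
  apply/funext => g /=; rewrite (retract_on_reduction rt1 tY1) ?pp2//.
  exact: p2.
exists (phi \o retract th1), (psi \o retract th2); split.
- apply: ehom.
    by apply: hom_on_comp hphi => //; exact: retract_hom.
  exact: etale_on_comp (retract_etale_on oY1 ct1 rt1 st1) ephi.
- apply: ehom.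
    by apply: hom_on_comp hpsi => //; exact: retract_hom.
  exact: etale_on_comp (retract_etale_on oY2 ct2 rt2 st2) epsi.
- by rewrite sr; exact: retract_similar.
- by rewrite rs; exact: retract_similar.
Qed.

Theorem theorem4p8 (G1 G2 : etale_groupoid) :
  compact [set: gunit G1] -> totally_disconnected [set: gunit G1] ->
  compact [set: gunit G2] -> totally_disconnected [set: gunit G2] ->
  kakutani_equivalent G1 G2 ->
  homologically_similar G1 G2 /\
  (forall (A : topologicalZmodType) (n : nat), homology_iso G1 G2 A n) /\
  H0_order_iso G1 G2.
Proof.
move=> c1 t1 c2 t2 ke.
have sim := kakutani_homologically_similar c1 t1 c2 t2 ke.
split=> //; split; last exact: homologically_similar_H0_order_iso.
by move=> A n; exact: homologically_similar_homology_iso.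
Qed.
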